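(* Let $R$ be a local ring of Krull dimension one with regular maximal ideal $M$, let $m\in M$ be a nonzerodivisor, and let $J=\bigcap_{i>0}m^iR$. The following are equivalent: (1) $R$ is a stable ring. (2) $R$ is a finitely stable ring with stable maximal ideal. (3) $R$ is a quadratic ring such that $\overline{R}$ has at most two maximal ideals. (4) $R\subseteq\overline{R}$ is a quadratic extension and $\overline{R}$ is a Dedekind ring with at most two maximal ideals. (5) $R/J$ is a stable ring.
   Context: All rings are commutative with identity; a local ring is a ring with a unique maximal ideal (not necessarily Noetherian). $Q(R)$ is the total ring of quotients, $\operatorname{Jac} R$ the Jacobson radical, and $\overline{R}$ the integral closure of $R$ in $Q(R)$. An ideal is regular if it contains a nonzerodivisor. A fractional ideal is an $R$-submodule $I$ of $Q(R)$ with $bI\subseteq R$ for some nonzerodivisor $b\in R$; for a regular one, $E(I)=\{q\in Q(R):qI\subseteq I\}$, and $I$ is stable if it is projective as an $E(I)$-module. $R$ is stable if every regular ideal of $R$ is stable, and finitely stable if every finitely generated regular ideal is stable. A ring $A$ is a Dedekind ring if every regular ideal of $A$ is invertible. An extension $R\subseteq S$ is quadratic if $xy\in xR+yR+R$ for all $x,y\in S$. If $\operatorname{Jac} R$ is regular, define $R_0=R$, $R_i=E(\operatorname{Jac} R_{i-1})$ for $i\ge1$, and $R_\infty=\bigcup_{i\ge1}R_i$. $R$ is a quadratic ring if $R$ is local, its maximal ideal is regular and stable, and $R\subseteq R_\infty$ is a quadratic extension. ($J$ does not depend on the choice of $m$.) *)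

(* Defs.v *)
From HB Require Import structures.
From mathcomp Require Import all_boot all_algebra.
Set Implicit Arguments. Unset Strict Implicit. Unset Printing Implicit Defensive.
Import GRing.Theory.
Local Open Scope ring_scope.

Definition psub {T : Type} (A B : T -> Prop) := forall x, A x -> B x.
Definition peq {T : Type} (A B : T -> Prop) := forall x, A x <-> B x.

Definition nzd {R : comNzRingType} (x : R) := forall y : R, x * y = 0 -> y = 0.

Definition is_ideal {R : comNzRingType} (I : R -> Prop) :=
  I 0 /\ (forall x y, I x -> I y -> I (x + y)) /\ (forall r x, I x -> I (r * x)).

Definition prime_ideal {R : comNzRingType} (P : R -> Prop) :=
  is_ideal P /\ ~ P 1 /\ (forall x y, P (x * y) -> P x \/ P y).

Definition maximal_ideal {R : comNzRingType} (M : R -> Prop) :=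
  is_ideal M /\ ~ M 1 /\
  (forall N, is_ideal N -> psub M N -> ~ N 1 -> psub N M).

Definition local_ring (R : comNzRingType) :=
  exists M : R -> Prop, maximal_ideal M /\ forall N, maximal_ideal N -> peq N M.

Definition strict_sub {T : Type} (A B : T -> Prop) := psub A B /\ exists x, B x /\ ~ A x.

Definition krull_dim_one (R : comNzRingType) :=
  (exists P0 P1 : R -> Prop, prime_ideal P0 /\ prime_ideal P1 /\ strict_sub P0 P1) /\
  ~ (exists P0 P1 P2 : R -> Prop, prime_ideal P0 /\ prime_ideal P1 /\ prime_ideal P2 /\
        strict_sub P0 P1 /\ strict_sub P1 P2).

Definition regular_ideal {R : comNzRingType} (I : R -> Prop) := exists x, I x /\ nzd x.

Definition fin_gen_ideal {R : comNzRingType} (I : R -> Prop) :=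
  exists s : seq R, forall x, I x <->
    exists c : seq R, size c = size s /\ x = \sum_(j < size s) c`_j * s`_j.

Definition is_total_quotient {R Q : comNzRingType} (i : {rmorphism R -> Q}) :=
  injective i /\
  (forall b : R, nzd b -> exists c : Q, i b * c = 1) /\
  (forall q : Q, exists a b : R, nzd b /\ q * i b = i a).

Section InQ.
Variables (R Q : comNzRingType) (i : {rmorphism R -> Q}).

Definition imgR (q : Q) := exists r : R, q = i r.
Definition img_ideal (I : R -> Prop) (q : Q) := exists r : R, I r /\ q = i r.

Definition Rsubmod (I : Q -> Prop) :=
  I 0 /\ (forall x y, I x -> I y -> I (x + y)) /\ (forall r x, I x -> I (i r * x)).

Definition fractional (I : Q -> Prop) :=
  Rsubmod I /\ exists b : R, nzd b /\ forall x, I x -> imgR (i b * x).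

Definition regular_frac (I : Q -> Prop) := exists x, I x /\ nzd x.

End InQ.

Definition Eset {Q : comNzRingType} (I : Q -> Prop) (q : Q) := forall x, I x -> I (q * x).

(* I is a projective A-module (A a subring of Q, I an A-submodule of Q):
   I is a direct summand (retract) of a free A-module A^(K).  Concretely,
   s : I -> A^(K) is given by its coordinate functions f k, the retraction
   p : A^(K) -> I by the images x k of the basis vectors, and p (s a) = a. *)
Definition projective_over {Q : comNzRingType} (A I : Q -> Prop) :=
  exists (K : eqType) (f : K -> Q -> Q) (x : K -> Q),
    (forall k, I (x k)) /\
    (forall k a, I a -> A (f k a)) /\
    (forall k a b, I a -> I b -> f k (a + b) = f k a + f k b) /\
    (forall k e a, A e -> I a -> f k (e * a) = e * f k a) /\
    (forall a, I a -> exists s : seq K,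
        uniq s /\ (forall k, f k a <> 0 -> k \in s) /\
        a = \sum_(k <- s) f k a * x k).

Definition stable_frac {Q : comNzRingType} (I : Q -> Prop) := projective_over (Eset I) I.

Section RingNotions.
Variables (R Q : comNzRingType) (i : {rmorphism R -> Q}).

Definition stable_ring :=
  forall I : R -> Prop, is_ideal I -> regular_ideal I -> stable_frac (img_ideal i I).

Definition fin_stable_ring :=
  forall I : R -> Prop, is_ideal I -> fin_gen_ideal I -> regular_ideal I ->
    stable_frac (img_ideal i I).

Definition Rbar (q : Q) := exists p : {poly R}, p \is monic /\ root (map_poly i p) q.

End RingNotions.

Section Subrings.
Variable Q : comNzRingType.

Definition nzd_in (A : Q -> Prop) (x : Q) := forall y, A y -> x * y = 0 -> y = 0.

Definition ideal_in (A I : Q -> Prop) :=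
  psub I A /\ I 0 /\ (forall x y, I x -> I y -> I (x + y)) /\
  (forall a x, A a -> I x -> I (a * x)).

Definition maximal_in (A I : Q -> Prop) :=
  ideal_in A I /\ ~ I 1 /\
  (forall J, ideal_in A J -> psub I J -> ~ J 1 -> psub J I).

Definition jac_in (A : Q -> Prop) (x : Q) := A x /\ forall I, maximal_in A I -> I x.

Definition Amodule (A J : Q -> Prop) :=
  J 0 /\ (forall x y, J x -> J y -> J (x + y)) /\ (forall a x, A a -> J x -> J (a * x)).

(* I invertible: I J = A for some A-submodule J of Q
   (I J subset A and 1 in I J, the latter as a finite sum of products) *)
Definition invertible_in (A I : Q -> Prop) :=
  exists J : Q -> Prop, Amodule A J /\ (forall x y, I x -> J y -> A (x * y)) /\
    exists s : seq (Q * Q), (forall p, p \in s -> I p.1 /\ J p.2) /\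
      \sum_(p <- s) p.1 * p.2 = 1.

Definition dedekind_in (A : Q -> Prop) :=
  forall I, ideal_in A I -> (exists x, I x /\ nzd_in A x) -> invertible_in A I.

Definition at_most_two_max (A : Q -> Prop) :=
  forall I1 I2 I3, maximal_in A I1 -> maximal_in A I2 -> maximal_in A I3 ->
    peq I1 I2 \/ peq I1 I3 \/ peq I2 I3.

Definition quadratic_ext (A B : Q -> Prop) :=
  psub A B /\ forall x y, B x -> B y ->
    exists a b c, A a /\ A b /\ A c /\ x * y = x * a + y * b + c.

End Subrings.

Section Quadratic.
Variables (R Q : comNzRingType) (i : {rmorphism R -> Q}).

Fixpoint Rseq (n : nat) : Q -> Prop :=
  match n with
  | 0 => imgR i
  | n'.+1 => Eset (jac_in (Rseq n'))
  end.

Definition Rinf (q : Q) := exists n, Rseq n.+1 q.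

Definition quadratic_ring :=
  local_ring R /\
  (forall M : R -> Prop, maximal_ideal M ->
     regular_ideal M /\ stable_frac (img_ideal i M)) /\
  quadratic_ext (imgR i) Rinf.

End Quadratic.

(* S is a stable ring (w.r.t. its total ring of quotients, which is unique
   up to isomorphism: we require it for every realization) *)
Definition stable_ring_abs (S : comNzRingType) :=
  forall (Q' : comNzRingType) (j : {rmorphism S -> Q'}),
    is_total_quotient j -> stable_ring j.

Definition quotient_stable (R : comNzRingType) (J : R -> Prop) :=
  forall (S : comNzRingType) (phi : {rmorphism R -> S}),
    (forall s, exists r, phi r = s) -> (forall r, phi r = 0 <-> J r) ->
    stable_ring_abs S.

(* Main.v *)
(* Write M for the maximal ideal, Q = R[1/m], A for the integral closure of R in Q. Over any regular
   ideal I, stability means that 1 = sum x_k y_k with x_k in I and y_k I I contained in I.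

   (1) => (2) is clear. For (2) => (3), stability of R + xR makes every x in Q whose powers have a
   common denominator quadratic over R; this places R_infty inside A, and the inverse of
   R + xR + yR over its endomorphism ring shows that this module is a ring for x, y in A. If A had
   three maximal ideals, the ideal generated by m and by elements with residues (1,0,1) and (0,1,1)
   would not be stable.

   For (3) => (4), quadraticity over R/M forces P^2 <= M R_infty, where P = Jac R_infty. Either
   R_infty is not local and P = M R_infty, or M^-1 P^2 contains a unit of R_infty, or
   M^-1 P^2 <= P and then M^-1 (Jac R_n) <= R_(n+1), so again P = M R_infty. In every case P is
   invertible, which makes R_infty completely integrally closed, hence equal to A, and, having at
   most two maximal ideals, Dedekind.

   For (4) => (1), at most two maximal ideals allow one to choose x in I with xA = IA; then x^-1 I
   lies between R and A, and is therefore a ring because R < A is quadratic.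

   Finally J = cap m^n R satisfies mJ = J and lies in every regular ideal, so that stability passes
   between R and R/J, whose total quotient ring is Q / JQ. *)
Require Import Defs.
From HB Require Import structures.
From mathcomp Require Import all_boot all_algebra.
From mathcomp Require Import boolp classical_sets.
From mathcomp Require Import ring.
Set Implicit Arguments. Unset Strict Implicit. Unset Printing Implicit Defensive.
Import GRing.Theory.
Local Open Scope ring_scope.

(** * Ideals of a subring *)

Lemma peqE (T : Type) (A B : T -> Prop) : peq A B -> A = B.
Proof. by move=> h; apply/funext => x; apply/propext. Qed.

(** Overrings of R are predicates on Q, so that ideals and maximal ideals of varying rings live in
    one type. *)
Definition subring {Q : comNzRingType} (A : Q -> Prop) :=
  [/\ A 1, forall x y, A x -> A y -> A (x - y) & forall x y, A x -> A y -> A (x * y)].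

Section Subring.
Variables (Q : comNzRingType) (A : Q -> Prop).
Hypothesis hA : subring A.

Lemma subring1 : A 1. Proof. by case: hA. Qed.
Lemma subringB x y : A x -> A y -> A (x - y).
Proof. by case: hA => _ h _; apply: h. Qed.
Lemma subringM x y : A x -> A y -> A (x * y).
Proof. by case: hA => _ _; apply. Qed.
Lemma subring0 : A 0.
Proof. by rewrite -(subrr 1); apply: subringB; apply: subring1. Qed.
Lemma subringN x : A x -> A (- x).
Proof. by rewrite -sub0r; apply: subringB; apply: subring0. Qed.
Lemma subringD x y : A x -> A y -> A (x + y).
Proof. by move=> hx hy; rewrite -(opprK y); apply: subringB => //; apply: subringN. Qed.
Lemma subringX x n : A x -> A (x ^+ n).
Proof.
by move=> hx; elim: n => [|n IH]; rewrite ?expr0 ?exprS; [exact: subring1|exact: subringM].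
Qed.
Lemma subring_sum (I : eqType) (s : seq I) (F : I -> Q) :
  (forall j, j \in s -> A (F j)) -> A (\sum_(j <- s) F j).
Proof.
move=> h; rewrite big_seq; apply: (@big_ind _ A); first exact: subring0.
  exact: subringD.
exact: h.
Qed.

Section Ideal.
Variable I : Q -> Prop.
Hypothesis hI : ideal_in A I.
Lemma idlS x : I x -> A x. Proof. by case: hI => h _; apply: h. Qed.
Lemma idl0 : I 0. Proof. by case: hI => _ []. Qed.
Lemma idlD x y : I x -> I y -> I (x + y).
Proof. by case: hI => _ [_ [h _]]; apply: h. Qed.
Lemma idlMl a x : A a -> I x -> I (a * x).
Proof. by case: hI => _ [_ [_ h]]; apply: h. Qed.
Lemma idlMr a x : A a -> I x -> I (x * a).
Proof. by rewrite mulrC; apply: idlMl. Qed.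
Lemma idlN x : I x -> I (- x).
Proof. by rewrite -mulN1r; apply: idlMl; apply/subringN/subring1. Qed.
Lemma idlB x y : I x -> I y -> I (x - y).
Proof. by move=> hx hy; apply: idlD => //; apply: idlN. Qed.
Lemma idl_sum (K : eqType) (s : seq K) (F : K -> Q) :
  (forall j, j \in s -> I (F j)) -> I (\sum_(j <- s) F j).
Proof.
move=> h; rewrite big_seq; apply: (@big_ind _ I); first exact: idl0.
  exact: idlD.
exact: h.
Qed.
End Ideal.

(** The avoided set S is arbitrary: S = {1} yields maximal ideals, and a multiplicative S yields
    primes. *)
Lemma Zorn_ideal (S I0 : Q -> Prop) : ideal_in A I0 -> (forall x, I0 x -> ~ S x) ->
  exists N, [/\ ideal_in A N, psub I0 N, forall x, N x -> ~ S x &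
    forall N', ideal_in A N' -> psub N N' -> (forall x, N' x -> ~ S x) -> psub N' N].
Proof.
move=> hI0 hS.
pose P (X : set Q) := X = set0 \/
  [/\ ideal_in A X, psub I0 X & forall x, X x -> ~ S x].
have [F FP Ftot|N [PN maxN]] := @Zorn_bigcup Q P.
  have [[X [FX [x Xx]]]|hF] := pselect (exists X, F X /\ exists x, X x); last first.
    left; apply/seteqP; split=> // x [X FX Xx]; apply: hF; exists X; split=> //.
    by exists x.
  right; have get Y : F Y -> (exists y, Y y) ->
      [/\ ideal_in A Y, psub I0 Y & forall x, Y x -> ~ S x].
    by move=> FY [y Yy]; case: (FP _ FY) => // Y0; rewrite Y0 in Yy.
  have gX : [/\ ideal_in A X, psub I0 X & forall x, X x -> ~ S x].
    by apply: get => //; exists x.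
  split.
  - split; first by move=> y [Y FY Yy]; have [[h _] _ _] := get _ FY (ex_intro _ _ Yy); apply: h.
    split; first by exists X => //; case: gX => [[_ [h _]] _ _].
    split=> [y z [Y FY Yy] [Z FZ Zz]|a y Aa [Y FY Yy]].
      have [hY _ _] := get _ FY (ex_intro _ _ Yy).
      have [hZ _ _] := get _ FZ (ex_intro _ _ Zz).
      have [YZ|ZY] := Ftot _ _ FY FZ.
        by exists Z => //; apply: (idlD hZ) => //; apply: YZ.
      by exists Y => //; apply: (idlD hY) => //; apply: ZY.
    exists Y => //; have [hY _ _] := get _ FY (ex_intro _ _ Yy).
    exact: (idlMl hY).
  - by move=> y I0y; exists X => //; case: gX => _ h _; apply: h.
  - by move=> y [Y FY Yy]; have [_ _ h] := get _ FY (ex_intro _ _ Yy); apply: h.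
case: PN => [N0|[hN I0N NS]].
  case: (maxN I0); last by right; split.
  by rewrite N0; split=> [x []|h]; case: (h _ (idl0 hI0)).
exists N; split=> // N' hN' NN' N'S x N'x; apply: contrapT => Nx.
apply: (maxN N'); last by right; split=> // y /I0N /NN'.
by split=> // h; apply: Nx; apply: h.
Qed.

Lemma maximal_above I0 : ideal_in A I0 -> ~ I0 1 ->
  exists N, maximal_in A N /\ psub I0 N.
Proof.
move=> hI0 h1; have [|N [hN I0N NS maxN]] := @Zorn_ideal (fun x => x = 1) I0 hI0.
  by move=> x I0x x1; apply: h1; rewrite -x1.
exists N; split=> //; split=> //; split=> [/NS//|N' hN' NN' N'1].
by apply: maxN => // x N'x x1; apply: N'1; rewrite -x1.
Qed.

Definition is_unit_in (x : Q) := exists y, A y /\ x * y = 1.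

Lemma principal_ideal x : A x -> ideal_in A (fun z => exists a, A a /\ z = x * a).
Proof.
move=> Ax; split; first by move=> _ [a [Aa ->]]; apply: subringM.
split; first by exists 0; split; [apply: subring0|rewrite mulr0].
split=> [_ _ [a [Aa ->]] [b [Ab ->]]|a _ Aa [b [Ab ->]]].
  by exists (a + b); split; [apply: subringD|rewrite mulrDr].
by exists (a * b); split; [apply: subringM|rewrite mulrCA].
Qed.

Lemma nonunit_maximal x : A x -> ~ is_unit_in x -> exists N, maximal_in A N /\ N x.
Proof.
move=> Ax nx; have [|N [mN hN]] := maximal_above (principal_ideal Ax).
  by move=> [a [Aa h]]; apply: nx; exists a.
by exists N; split=> //; apply: hN; exists 1; rewrite mulr1; split=> //; apply: subring1.
Qed.

Lemma maximal_comax N x : maximal_in A N -> A x -> ~ N x ->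
  exists a n, [/\ A a, N n & x * a + n = 1].
Proof.
move=> [hN [N1 maxN]] Ax Nx; apply: contrapT => h.
apply: Nx; apply: (maxN (fun z => exists a n, [/\ A a, N n & x * a + n = z])).
- split; first by move=> _ [a [n [Aa Nn <-]]]; apply: subringD; [apply: subringM|apply: (idlS hN)].
  split; first by exists 0, 0; split; [apply: subring0|apply: (idl0 hN)|rewrite mulr0 addr0].
  split=> [_ _ [a [n [Aa Nn <-]]] [b [k [Ab Nk <-]]]|b _ Ab [a [n [Aa Nn <-]]]].
    by exists (a + b), (n + k); split; [apply: subringD|apply: (idlD hN)|ring].
  by exists (b * a), (b * n); split; [apply: subringM|apply: (idlMl hN)|ring].
- by move=> n Nn; exists 0, n; split=> //; [apply: subring0|rewrite mulr0 add0r].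
- by move=> h1; apply: h.
- by exists 1, 0; split; [apply: subring1|apply: (idl0 hN)|rewrite mulr1 addr0].
Qed.

Lemma maximal_prime N x y : maximal_in A N -> A x -> A y -> N (x * y) -> N x \/ N y.
Proof.
move=> mN Ax Ay Nxy; have [Nx|Nx] := pselect (N x); [by left|right].
have [hN _] := mN.
have [a [n [Aa Nn e]]] := maximal_comax mN Ax Nx.
have -> : y = a * (x * y) + y * n by rewrite -[LHS]mulr1 -e; ring.
by apply: (idlD hN); apply: (idlMl hN).
Qed.

Lemma maximal_pow N x n : maximal_in A N -> A x -> N (x ^+ n) -> N x.
Proof.
move=> mN Ax; elim: n => [|n IH]; first by rewrite expr0; case: mN => _ [].
rewrite exprS => h; case: (maximal_prime mN Ax _ h) => //.
exact: subringX.
Qed.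

Lemma jac_ideal : ideal_in A (jac_in A).
Proof.
have g N : maximal_in A N -> ideal_in A N by case.
split; first by move=> x [].
split; first by split=> [|N /g hN]; [apply: subring0|apply: (idl0 hN)].
split=> [x y [Ax hx] [Ay hy]|a x Aa [Ax hx]].
  by split=> [|N mN]; [apply: subringD|apply: (idlD (g _ mN)); [apply: hx|apply: hy]].
by split=> [|N mN]; [apply: subringM|apply: (idlMl (g _ mN)) => //; apply: hx].
Qed.

Lemma jac_unit x : jac_in A x -> is_unit_in (1 - x).
Proof.
move=> [Ax hx]; apply: contrapT => h.
have A1x : A (1 - x) by apply: subringB => //; apply: subring1.
have [N [mN Nx]] := nonunit_maximal A1x h.
have [hN [N1 _]] := mN; apply: N1.
by rewrite -(subrK x 1); apply: (idlD hN) => //; apply: hx.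
Qed.

Lemma unit_not_max N x : maximal_in A N -> is_unit_in x -> ~ N x.
Proof. by move=> [hN [N1 _]] [y [Ay e]] Nx; apply: N1; rewrite -e; apply: (idlMr hN). Qed.

End Subring.

(** * Stability inside R *)

Lemma seq_choice (T : eqType) (U : Type) (P : T -> U -> Prop) (s : seq T) (u0 : U) :
  (forall x, x \in s -> exists y, P x y) ->
  exists f : T -> U, forall x, x \in s -> P x (f x).
Proof.
move=> h; have [x|f hf] := @choice T U (fun x y => x \in s -> P x y); last by exists f.
have [xs|_] := boolP (x \in s); last by exists u0.
by have [y Py] := h _ xs; exists y.
Qed.

Lemma is_ideal_in (R : comNzRingType) (I : R -> Prop) :
  is_ideal I <-> ideal_in (fun _ => True) I.
Proof.
split=> [[I0 [ID IM]]|[_ [I0 [ID IM]]]]; first by split=> //; split=> //; split=> // a x _; apply: IM.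
by split=> //; split=> // a x; apply: IM.
Qed.

Lemma maximal_ideal_in (R : comNzRingType) (I : R -> Prop) :
  maximal_ideal I <-> maximal_in (fun _ => True) I.
Proof.
split=> [[/is_ideal_in hI [I1 maxI]]|[hI [I1 maxI]]]; split; rewrite ?is_ideal_in //; split=> // N.
  by move=> hN; apply: maxI; apply/is_ideal_in.
by move=> /is_ideal_in hN; apply: maxI.
Qed.

Lemma subring_top (R : comNzRingType) : subring (fun _ : R => True).
Proof. by []. Qed.

(** Krull's argument: if P is maximal among the ideals missing S and x, y lie outside P, then P + xR
    and P + yR both meet S. The product of the meeting points is in S, and it would be in P if xy
    were. *)
Lemma avoid_prime (R : comNzRingType) (S I0 : R -> Prop) : is_ideal I0 ->
  (forall x, I0 x -> ~ S x) -> S 1 -> (forall x y, S x -> S y -> S (x * y)) ->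
  exists P, [/\ prime_ideal P, psub I0 P & forall x, P x -> ~ S x].
Proof.
move=> /is_ideal_in hI0 hS S1 SM.
have [P [hP IP PS maxP]] := Zorn_ideal hI0 hS; exists P; split=> //.
split; first exact/is_ideal_in.
split=> [/PS//|x y Pxy]; apply: contrapT => /not_orP[Px Py].
have key z : ~ P z -> exists a p, P p /\ S (z * a + p).
  move=> Pz; apply: contrapT => h; apply: Pz.
  apply: (maxP (fun t => exists a p, P p /\ z * a + p = t)).
  - split=> //; split; first by exists 0, 0; split; [apply: (idl0 hP)|rewrite mulr0 addr0].
    split=> [_ _ [a [p [Pp <-]]] [b [q [Pq <-]]]|b _ _ [a [p [Pp <-]]]].
      by exists (a + b), (p + q); split; [apply: (idlD hP)|ring].
    by exists (b * a), (b * p); split; [apply: (idlMl hP)|ring].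
  - by move=> p Pp; exists 0, p; rewrite mulr0 add0r.
  - by move=> _ [a [p [Pp <-]]] St; apply: h; exists a, p.
  by exists 1, 0; split; [apply: (idl0 hP)|rewrite mulr1 addr0].
have [a [p [Pp Sp]]] := key _ Px; have [b [q [Pq Sq]]] := key _ Py.
apply: (PS _ _ (SM _ _ Sp Sq)).
have -> : (x * a + p) * (y * b + q) = (a * b) * (x * y) + ((x * a + p) * q + (y * b) * p) by ring.
by apply: (idlD hP); [apply: (idlMl hP)|apply: (idlD hP); apply: (idlMl hP)].
Qed.

(** * Local rings of Krull dimension one *)

Section Local.
Variables (R : comNzRingType) (M : R -> Prop).
Hypotheses (hloc : local_ring R) (hM : maximal_ideal M).

Lemma local_max N : maximal_ideal N -> N = M.
Proof.
have [M0 [_ h]] := hloc; move=> mN; apply: peqE => x; have := h _ mN x; have := h _ hM x; tauto.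
Qed.

Lemma local_unit x : ~ M x -> exists y, x * y = 1.
Proof.
move=> Mx; apply: contrapT => h.
have [||N [mN Nx]] := @nonunit_maximal _ _ (@subring_top R) x; first by [].
  by move=> [y [_ e]]; apply: h; exists y.
by move/maximal_ideal_in: mN => mN; apply: Mx; rewrite -(local_max mN).
Qed.

Lemma local_ideal_sub I : is_ideal I -> ~ I 1 -> psub I M.
Proof.
move=> hI I1 x Ix; apply: contrapT => /local_unit [y e]; apply: I1.
by rewrite -e mulrC; case: hI => _ [_]; apply.
Qed.

Lemma M_ideal : is_ideal M. Proof. by case: hM. Qed.
Lemma M_prime x y : M (x * y) -> M x \/ M y.
Proof. by move/maximal_ideal_in: hM => h; apply: (maximal_prime _ h). Qed.

(* The hypothesis on b says that b is a nonzerodivisor modulo K: both K = 0 and K = J are needed. *)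
Lemma dim_one_nil (K : R -> Prop) b x : krull_dim_one R -> is_ideal K ->
  (forall y, K (b * y) -> K y) -> M x -> exists n r, K (x ^+ n - b * r).
Proof.
move=> [_ hdim] hK hb Mx; apply: contrapT => hn; apply: hdim.
have kK := proj1 (is_ideal_in K) hK.
(* If no power of x lies in K + bR, some prime P over K + bR omits x and is thus strictly inside
   M. *)
have [|||y z|P [Ppr bP PS]] := @avoid_prime R (fun t => exists n, t = x ^+ n)
    (fun t => exists r, K (t - b * r)).
- split; first by exists 0; rewrite mulr0 subrr; apply: (idl0 kK).
  split=> [y z [r Kr] [s Ks]|a y [r Kr]].
      exists (r + s); have -> : y + z - b * (r + s) = (y - b * r) + (z - b * s) by ring.
    exact: (idlD kK).
  exists (a * r); have -> : a * y - b * (a * r) = a * (y - b * r) by ring.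
  exact: (idlMl kK).
- by move=> y [r Kr] [n e]; apply: hn; exists n, r; rewrite -e.
- by exists 0.
- by move=> [n ->] [k ->]; exists (n + k)%N; rewrite exprD.
have [hP [P1 Pprime]] := Ppr.
(* The products s b^n with s outside P miss K, since b cancels modulo K and K is inside P. The
   resulting prime P0 is inside P and omits b, so P0 < P < M contradicts dimension one. *)
have [|||y z|P0 [P0pr KP0 P0S]] := @avoid_prime R (fun t => exists s n, ~ P s /\ t = s * b ^+ n) K.
- exact: hK.
- move=> y Ky [s [n [Ps e]]]; apply: Ps; apply: bP; exists 0; rewrite mulr0 subr0.
  move: Ky; rewrite {}e; elim: n => [|n IH]; first by rewrite expr0 mulr1.
  by rewrite exprS mulrCA => /hb.
- by exists 1, 0; split=> //; rewrite mul1r.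
- move=> [s [n [Ps ->]]] [t [k [Pt ->]]]; exists (s * t), (n + k)%N; split; last by rewrite exprD; ring.
  by move=> /Pprime [].
exists P0, P, M; split=> //; split=> //; split.
  split; first exact: M_ideal; split; last exact: M_prime.
  by case: hM => _ [].
split; split.
- by move=> y P0y; apply: contrapT => Py; apply: (P0S _ P0y); exists y, 0; split=> //; rewrite mulr1.
- exists b; split; first by apply: bP; exists 1; rewrite mulr1 subrr; apply: (idl0 kK).
  by move=> P0b; apply: (P0S _ P0b); exists 1, 1; rewrite mul1r.
- exact: local_ideal_sub.
- by exists x; split=> // Px; apply: (PS _ Px); exists 1.
Qed.
End Local.

(** * Stability as invertibility over the endomorphism ring *)

Section Criterion.
Variables (R Q : comNzRingType) (i : {rmorphism R -> Q}).
Hypothesis hQ : is_total_quotient i.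

Lemma i_inj : injective i. Proof. by case: hQ. Qed.

Lemma nzd_unit b : nzd b -> exists c, i b * c = 1.
Proof. by case: hQ => _ [h _]; apply: h. Qed.

Lemma nzdM (x y : R) : nzd x -> nzd y -> nzd (x * y).
Proof. by move=> hx hy z; rewrite -mulrA => /hx /hy. Qed.

Lemma nzdX (x : R) n : nzd x -> nzd (x ^+ n).
Proof.
move=> hx; elim: n => [|n IH]; first by move=> y; rewrite mul1r.
by rewrite exprS; apply: nzdM.
Qed.

Lemma nzd_of_unit x c : i x * c = 1 -> nzd x.
Proof.
move=> e y xy; apply: i_inj; rewrite rmorph0 -[i y]mul1r -e mulrAC -rmorphM xy rmorph0.
by rewrite mul0r.
Qed.

Lemma fracP (q : Q) : exists a b, nzd b /\ q * i b = i a.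
Proof. by case: hQ => _ [_]. Qed.

Lemma nzdQ_unit (q : Q) : nzd q -> exists c, q * c = 1.
Proof.
move=> hq; have [a [b [hb e]]] := fracP q.
have [y ay|c hc] := @nzd_unit a; last by exists (i b * c); rewrite mulrA e.
apply: hb; apply: i_inj; rewrite rmorph0; apply: hq.
by rewrite rmorphM mulrA e -rmorphM ay rmorph0.
Qed.

Lemma common_denom (s : seq Q) :
  exists b, nzd b /\ forall q, q \in s -> exists a, q * i b = i a.
Proof.
elim: s => [|q s [b [hb IH]]]; first by exists 1; split=> // y; rewrite mul1r.
have [a [d [hd e]]] := fracP q; exists (d * b); split; first exact: nzdM.
move=> z; rewrite inE => /predU1P[->|/IH[c ec]].
  by exists (a * b); rewrite !rmorphM mulrA e.
by exists (d * c); rewrite !rmorphM mulrCA ec.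
Qed.

(** The condition on [p.2] says that [p.2] carries I into E(I), so this is invertibility of I over
    E(I). *)
Definition invertible_frac (I : Q -> Prop) := exists s : seq (Q * Q),
  (forall p, p \in s -> I p.1 /\ forall z w, I z -> I w -> I (p.2 * z * w)) /\
  \sum_(p <- s) p.1 * p.2 = 1.

Section Ideal.
Variable I : R -> Prop.
Hypotheses (hI : is_ideal I) (rI : regular_ideal I).
Let iI := img_ideal i I.

Let iIM r x : iI x -> iI (i r * x).
Proof. by move=> [a [Ia ->]]; exists (r * a); rewrite rmorphM; split=> //; case: hI => _ [_ h]; apply: h. Qed.

(** The dual basis lemma: I contains a unit v of Q, so each E(I)-linear coordinate function is
    multiplication by its value at v divided by v. *)
Lemma stable_fracP : stable_frac iI <-> invertible_frac iI.
Proof.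
split=> [[K [f [x [Ix [fE [fD [fM fsum]]]]]]]|[s [hs s1]]].
  have [v0 [Iv0 nv0]] := rI; have [w vw] := nzd_unit nv0.
  have Iv : iI (i v0) by exists v0.
  have RE r : Eset iI (i r) by move=> z; apply: iIM.
  have fy k a : iI a -> f k a = f k (i v0) * w * a.
    move=> [a0 [Ia0 ->]]; have Ia : iI (i a0) by exists a0.
    have : i v0 * f k (i a0) = i a0 * f k (i v0) by rewrite -!fM // mulrC.
    by move=> e; rewrite -[LHS]mul1r -vw mulrAC e; ring.
  have [s [us [hs e]]] := fsum _ Iv.
  exists [seq (x k, f k (i v0) * w) | k <- s]; split.
    move=> p /mapP[k ks ->] /=; split=> // z t Iz It.
    by rewrite -(fy k z) //; apply: fE.
  rewrite big_map /= -vw [X in _ = X * _]e mulr_suml; apply: eq_bigr => k _; ring.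
(* The basis is indexed by positions, because s may repeat a pair. *)
exists 'I_(size s), (fun (k : 'I_(size s)) z => (nth (0, 0) s k).2 * z),
  (fun k : 'I_(size s) => (nth (0, 0) s k).1).
have hn (k : 'I_(size s)) : nth (0, 0) s k \in s by apply: mem_nth.
split; first by move=> k; case: (hs _ (hn k)).
split; first by move=> k a Ia z Iz; case: (hs _ (hn k)) => _; apply.
split; first by move=> k a b _ _; rewrite mulrDr.
split; first by move=> k e a _ _; rewrite mulrCA.
move=> a Ia; exists (enum 'I_(size s)); split; first exact: enum_uniq.
split; first by move=> k _; rewrite mem_enum.
rewrite -[LHS]mul1r -s1 big_enum /= (big_nth (0, 0)) big_mkord mulr_suml.
by apply: eq_bigr => k _; ring.
Qed.

(* Stability expressed inside R, with b a common denominator of the generators of the inverse. *)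
Definition stab_den (b : R) := nzd b /\ exists s : seq (R * R),
  (forall p, p \in s -> I p.1 /\
     forall z w, I z -> I w -> exists t, I t /\ p.2 * z * w = b * t) /\
  \sum_(p <- s) p.1 * p.2 = b.

Lemma stab_denP : invertible_frac iI <-> exists b, stab_den b.
Proof.
split=> [[s [hs s1]]|[b [hb [s [hs s1]]]]].
  have [b [hb den]] := common_denom [seq p.2 | p <- s].
  have [|f hf] := @seq_choice (Q * Q)%type (R * R)%type
    (fun p r => [/\ I r.1, p.1 = i r.1 & p.2 * i b = i r.2]) s (0, 0).
    move=> p ps; have [[r [Ir e]] _] := hs _ ps.
    by have [|a ea] := den p.2; [exact: map_f|exists (r, a)].
  exists b; split=> //; exists [seq f p | p <- s]; split.
    move=> _ /mapP[p ps ->]; have [I1 e1 e2] := hf _ ps; split=> // z w Iz Iw.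
    have [_ h] := hs _ ps; have [||t [It e]] := h (i z) (i w); [by exists z|by exists w|].
    exists t; split=> //; apply: i_inj; rewrite !rmorphM -e2 -e; ring.
  apply: i_inj; rewrite big_map rmorph_sum /= -[RHS]mul1r -s1 mulr_suml.
  by apply: eq_big_seq => p ps; have [_ e1 e2] := hf _ ps; rewrite rmorphM -e1 -e2 mulrA.
have [c hc] := nzd_unit hb.
exists [seq (i p.1, i p.2 * c) | p <- s]; split.
  move=> _ /mapP[p ps ->] /=; have [I1 h] := hs _ ps; split; first by exists p.1.
  move=> _ _ [z [Iz ->]] [w [Iw ->]]; have [t [It e]] := h _ _ Iz Iw; exists t; split=> //.
  have -> : i p.2 * c * i z * i w = i (p.2 * z * w) * c by rewrite !rmorphM; ring.
  by rewrite e rmorphM mulrAC hc mul1r.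
rewrite big_map -hc -[X in _ = i X * _]s1 rmorph_sum mulr_suml /=; apply: eq_bigr => p _ /=.
by rewrite rmorphM; ring.
Qed.

End Ideal.
End Criterion.

(** * The quotient by J *)

Section Setup.
Variables (R : comNzRingType) (M : R -> Prop) (m : R).
Hypotheses (hloc : local_ring R) (hdim : krull_dim_one R) (hM : maximal_ideal M).
Hypotheses (hmM : M m) (hm : nzd m).

(** The case K = 0 of [dim_one_nil]; for x = m it says that Q = R[1/m]. *)
Lemma nzd_dvd_pow b x : nzd b -> M x -> exists n r, x ^+ n = b * r.
Proof.
move=> hb Mx; have [|y e||n [r /= e]] := @dim_one_nil R M hloc hM (fun y => y = 0) b x hdim.
- by split=> //; split=> [x0 y -> ->|r x0 ->]; rewrite ?addr0 ?mulr0.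
- exact: hb.
- exact: Mx.
by exists n, r; apply/eqP; rewrite -subr_eq0 e.
Qed.

Definition Jm (r : R) := forall k : nat, (0 < k)%N -> exists s : R, r = m ^+ k * s.

Lemma Jm_ideal : is_ideal Jm.
Proof.
split; first by move=> k _; exists 0; rewrite mulr0.
split=> [x y hx hy k k0|r x hx k k0].
  by have [s ->] := hx _ k0; have [t ->] := hy _ k0; exists (s + t); rewrite mulrDr.
by have [s ->] := hx _ k0; exists (r * s); rewrite mulrCA.
Qed.
Let kJ := proj1 (is_ideal_in _) Jm_ideal.

Lemma nzd_cancel (x y z : R) : nzd x -> x * y = x * z -> y = z.
Proof. by move=> hx e; apply/eqP; rewrite -subr_eq0; apply/eqP/hx; rewrite mulrBr e subrr. Qed.

(** Cancelling m^(n+1) in x = m^(n+1+k) s for every k leaves a quotient that is again in J; hence J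
    = m^n J. *)
Lemma Jm_div x n : Jm x -> exists y, Jm y /\ x = m ^+ n * y.
Proof.
case: n => [|n]; first by exists x; rewrite mul1r.
move=> hx; have [y e] := hx n.+1 isT; exists y; split=> // k k0.
have [s es] := hx (n.+1 + k)%N isT; exists s.
by apply: (nzd_cancel (@nzdX _ _ n.+1 hm)); rewrite -e es exprD mulrA.
Qed.

Lemma Jm_mul n y : Jm (m ^+ n * y) -> Jm y.
Proof. by move=> /(@Jm_div _ n) [z [Jz /(nzd_cancel (nzdX hm)) ->]]. Qed.

Lemma Jm_sub : psub Jm M.
Proof. by move=> x /(_ 1 isT) [s ->]; rewrite mulrC; case: (M_ideal hM) => _ [_]; apply. Qed.

Lemma unit1D j : M j -> exists u, (1 + j) * u = 1.
Proof.
move=> Mj; apply: (local_unit hloc hM) => h.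
have [_ [MD MM]] := M_ideal hM; case: hM => _ [M1 _]; apply: M1.
have -> : 1 = (1 + j) + (-1) * j by ring.
by apply: MD => //; apply: MM.
Qed.

Lemma regular_pow I : is_ideal I -> regular_ideal I -> exists n, I (m ^+ n).
Proof.
move=> [_ [_ IM]] [y [Iy hy]]; have [n [r e]] := nzd_dvd_pow hy hmM.
by exists n; rewrite e mulrC; apply: IM.
Qed.

Section Quotient.
Variables (S : comNzRingType) (phi : {rmorphism R -> S}).
Hypotheses (surj : forall s, exists r, phi r = s) (ker : forall r, phi r = 0 <-> Jm r).

Lemma phi_eq x y : phi x = phi y <-> Jm (x - y).
Proof.
rewrite -ker rmorphB; split=> [->|/eqP]; first by rewrite subrr.
by rewrite subr_eq0 => /eqP.
Qed.

(** The case K = J of [dim_one_nil]: inverting the image of m inverts every nonzerodivisor of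
    R/J. *)
Lemma phi_nzd_dvd b : nzd (phi b) -> exists n r, phi (m ^+ n) = phi (b * r).
Proof.
move=> hb; have [|n [r h]] := @dim_one_nil R M hloc hM Jm b m hdim Jm_ideal _ hmM.
  by move=> y /ker; rewrite rmorphM => /hb /ker.
by exists n, r; apply/phi_eq.
Qed.

Lemma phi_nzd b : nzd b -> nzd (phi b).
Proof.
move=> hb s; have [z <-] := surj s; rewrite -rmorphM => /ker h; apply/ker.
have [n [r e]] := nzd_dvd_pow hb hmM; apply: (@Jm_mul n).
by rewrite e -mulrA mulrCA; apply: (idlMl kJ).
Qed.

Lemma stab_den_quotient I' : is_ideal I' -> 
  (exists b, stab_den (fun r => I' (phi r)) b) -> exists b, stab_den I' b.
Proof.
move=> hI' [b [hb [s [hs e]]]]; exists (phi b); split; first exact: phi_nzd.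
exists [seq (phi p.1, phi p.2) | p <- s]; split; last first.
  by rewrite -e big_map rmorph_sum; apply: eq_bigr => p _; rewrite rmorphM.
move=> _ /mapP[p ps ->] /=; have [I1 h] := hs _ ps; split=> // z' w'.
have [z <-] := surj z'; have [w <-] := surj w' => Iz Iw.
by have [t [It et]] := h _ _ Iz Iw; exists (phi t); rewrite -!rmorphM et.
Qed.

Lemma regular_preimage I' : is_ideal I' -> regular_ideal I' ->
  regular_ideal (fun r => I' (phi r)).
Proof.
move=> [_ [_ IM]] [y' [Iy hy]]; have [y ey] := surj y'; rewrite -ey in Iy hy.
have [n [r e]] := phi_nzd_dvd hy; exists (m ^+ n); split; last exact: nzdX.
by rewrite e mulrC rmorphM; apply: IM.
Qed.

(** Relations lift from R/J only up to errors in J. These are absorbed because J = m^n J, J lies in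
    I, and 1 + J consists of units. *)
Lemma stab_den_lift I : is_ideal I -> regular_ideal I ->
  (exists b, stab_den (fun s => exists r, I r /\ s = phi r) b) -> exists b, stab_den I b.
Proof.
move=> hI rI [b' [hb' [s' [hs' e']]]]; have kI := proj1 (is_ideal_in _) hI.
have [k Ik] := regular_pow hI rI.
have JI : psub Jm I.
  by move=> x /(@Jm_div _ k) [y [_ ->]]; apply: (idlMr kI).
have [b eb] := surj b'; rewrite -eb in hb'.
have [n [r er]] := phi_nzd_dvd hb'.
have [|f hf] := @seq_choice (S * S)%type (R * R)%type
    (fun p q => [/\ I q.1, p.1 = phi q.1 & p.2 = phi q.2]) s' (0, 0).
  move=> p ps; have [[x [Ix ex]] _] := hs' _ ps; have [y ey] := surj p.2.
  by exists (x, y).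
pose t := \sum_(p <- s') (f p).1 * (f p).2.
(* Hence t r = m^n (1 + j) with j in J; multiplying by the inverse u of 1 + j makes m^n the new
   denominator. *)
have ht : Jm (t * r - m ^+ n).
  apply/phi_eq; rewrite rmorphM er rmorphM eb -e' rmorph_sum; congr (_ * _).
  by apply: eq_big_seq => p ps; have [_ -> ->] := hf _ ps; rewrite rmorphM.
have [j [Jj ej]] := Jm_div n ht.
have [u eu] := unit1D (Jm_sub Jj).
exists (m ^+ n); split; first exact: nzdX.
exists [seq ((f p).1, (f p).2 * (r * u)) | p <- s']; split; last first.
  rewrite big_map /=.
  have -> : \sum_(p <- s') (f p).1 * ((f p).2 * (r * u)) = t * (r * u).
    by rewrite /t mulr_suml; apply: eq_bigr => p _; ring.
  by rewrite mulrA -(subrK (m ^+ n) (t * r)) ej -[in RHS](mulr1 (m ^+ n)) -eu; ring.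
move=> _ /mapP[p ps ->] /=; have [I1 e1 e2] := hf _ ps; split=> // z w Iz Iw.
have [_ h] := hs' _ ps.
have [||_ [[v [Iv ->]] ev]] := h (phi z) (phi w); [by exists z|by exists w|].
have hv : Jm ((f p).2 * z * w - b * v) by apply/phi_eq; rewrite !rmorphM -e2 ev eb.
have hr : Jm (b * r - m ^+ n) by apply/phi_eq.
(* The errors in the stability relation and in b r = m^n combine to m^n j1, and j1 lies in I. *)
have [j1 [Jj1 ej1]] : exists y, Jm y /\ ((f p).2 * z * w - b * v) * r + (b * r - m ^+ n) * v = m ^+ n * y.
  by apply: Jm_div; apply: (idlD kJ); apply: (idlMr kJ).
exists ((v + j1) * u); split; first by apply: (idlMr kI) => //; apply: (idlD kI) => //; apply: JI.
have -> : (f p).2 * (r * u) * z * w =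
  (((f p).2 * z * w - b * v) * r + (b * r - m ^+ n) * v + m ^+ n * v) * u by ring.
by rewrite ej1; ring.
Qed.

End Quotient.
End Setup.

Lemma quotient_ring (R : comNzRingType) (K : R -> Prop) : is_ideal K -> ~ K 1 ->
  exists (S : comNzRingType) (phi : {rmorphism R -> S}),
    (forall s, exists r, phi r = s) /\ (forall r, phi r = 0 <-> K r).
Proof.
move=> [K0 [KD KM]] K1.
pose P : R -> bool := fun x => `[< K x >].
have hP : idealr_closed P.
  split; [by apply/asboolP|by apply/negP => /asboolP|].
  move=> a x y /asboolP Kx /asboolP Ky; apply/asboolP.
  by apply: KD => //; apply: KM.
pose kP := isIdealr.Build R P hP.
pose I : idealr R := HB.pack P kP.
exists {ideal_quot I}, (\pi_({ideal_quot I}))%qT; split.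
  by move=> s; exists (generic_quotient.repr s); exact: generic_quotient.reprK.
move=> r; rewrite -(rmorph0 (\pi_({ideal_quot I})%qT)); split.
  by move/eqP; rewrite -Quotient.idealrBE subr0 => /asboolP.
by move=> Kr; apply/eqP; rewrite -Quotient.idealrBE subr0; apply/asboolP.
Qed.

Lemma induced_morphism (R Q S Q' : comNzRingType) (i : {rmorphism R -> Q})
  (phi : {rmorphism R -> S}) (psi : {rmorphism Q -> Q'}) :
  (forall s, exists r, phi r = s) -> (forall r, phi r = 0 -> psi (i r) = 0) ->
  exists j : {rmorphism S -> Q'}, forall r, j (phi r) = psi (i r).
Proof.
move=> surj ker; have [g hg] := choice surj.
pose f s := psi (i (g s)).
have hf r : f (phi r) = psi (i r).
  apply/eqP; rewrite /f -subr_eq0 -!rmorphB; apply/eqP/ker.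
  by rewrite rmorphB hg subrr.
have fB : zmod_morphism f.
  by move=> x y; rewrite -(hg x) -(hg y) -rmorphB !hf !rmorphB.
have fM : monoid_morphism f.
  split; first by rewrite -(rmorph1 phi) hf !rmorph1.
  by move=> x y; rewrite -(hg x) -(hg y) -rmorphM !hf !rmorphM.
pose j : {rmorphism S -> Q'} := HB.pack f
  (GRing.isZmodMorphism.Build S Q' f fB) (GRing.isMonoidMorphism.Build S Q' f fM).
by exists j.
Qed.

(** * Integral overrings *)

Section NilMod.
Variables (Q : comNzRingType) (A : Q -> Prop).
Hypothesis hA : subring A.

(** The radical of cA in A. *)
Definition nilmod (c z : Q) := A z /\ exists n a, A a /\ z ^+ n = c * a.

Lemma nilmodD c x y : A c -> nilmod c x -> nilmod c y -> nilmod c (x + y).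
Proof.
move=> Ac [Ax [n [a [Aa ea]]]] [Ay [k [b [Ab eb]]]]; split; first exact: subringD.
(* In each binomial term either x has exponent at least n or y has exponent at least k. *)
have g j : exists t, A t /\ x ^+ (n + k - j) * y ^+ j = c * t.
  have [kj|jk] := leqP k j.
    exists (x ^+ (n + k - j) * (b * y ^+ (j - k))); split.
      by do ![apply: subringM|apply: subringX].
    by rewrite -{2}(subnK kj) addnC exprD eb; ring.
  exists (a * x ^+ (k - j) * y ^+ j); split; first by do ![apply: subringM|apply: subringX].
  by rewrite -addnBA ?(ltnW jk) // exprD ea; ring.
have [f hf] := choice g.
exists (n + k)%N, (\sum_(j < (n + k).+1) f j *+ 'C(n + k, j)); split.
  apply: subring_sum => // j _; have [h _] := hf j.
  by elim: 'C(_, _) => [|d IH]; rewrite ?mulr0n ?mulrS; [apply: subring0|apply: subringD].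
rewrite exprDn mulr_sumr; apply: eq_bigr => j _.
by have [_ ->] := hf j; rewrite mulrnAr.
Qed.

Lemma nilmodM c a x : A a -> nilmod c x -> nilmod c (a * x).
Proof.
move=> Aa [Ax [n [b [Ab e]]]]; split; first exact: subringM.
exists n, (a ^+ n * b); split; first by apply: subringM => //; apply: subringX.
by rewrite exprMn e mulrCA.
Qed.

End NilMod.

Section Overrings.
Variables (R Q : comNzRingType) (i : {rmorphism R -> Q}) (M : R -> Prop) (m : R).
Hypotheses (hQ : is_total_quotient i).
Hypotheses (hloc : local_ring R) (hdim : krull_dim_one R) (hM : maximal_ideal M).
Hypotheses (hmM : M m) (hm : nzd m).

Let kM := proj1 (is_ideal_in M) (M_ideal hM).
Let M1 : ~ M 1. Proof. by case: hM => _ []. Qed.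

Lemma imgR_i r : imgR i (i r). Proof. by exists r. Qed.

Lemma imgR_subring : subring (imgR i).
Proof.
split; first by exists 1; rewrite rmorph1.
  by move=> _ _ [a ->] [b ->]; exists (a - b); rewrite rmorphB.
by move=> _ _ [a ->] [b ->]; exists (a * b); rewrite rmorphM.
Qed.

Lemma RbarP q : Rbar i q <-> integralOver i q.
Proof. by split=> [[p [h1 h2]]|[p h1 h2]]; exists p. Qed.

Lemma Rbar_subring : subring (Rbar i).
Proof.
split=> [|x y /RbarP hx /RbarP hy|x y /RbarP hx /RbarP hy]; apply/RbarP.
- exact: integral1.
- exact: integral_sub.
- exact: integral_mul.
Qed.

Lemma Rbar_i r : Rbar i (i r). Proof. by apply/RbarP; apply: integral_id. Qed.

Definition int_ring (A : Q -> Prop) := [/\ subring A, psub (imgR i) A & psub A (Rbar i)].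

Lemma Rbar_int_ring : int_ring (Rbar i).
Proof. by split; [apply: Rbar_subring|move=> _ [r ->]; apply: Rbar_i|]. Qed.

Lemma mpow_den q : exists n, imgR i (i (m ^+ n) * q).
Proof.
have [a [b [hb e]]] := fracP hQ q; have [n [r er]] := nzd_dvd_pow hloc hdim hM hb hmM.
by exists n, (r * a); rewrite er !rmorphM -e; ring.
Qed.

Definition almost_integral (q : Q) := exists s, forall n, imgR i (i (m ^+ s) * q ^+ n).

Lemma root_sum (p : {poly R}) q : root (map_poly i p) q ->
  \sum_(j < size p) i p`_j * q ^+ j = 0.
Proof.
move=> /rootP; rewrite (@horner_coef_wide _ (size p)); last exact: size_poly.
by move=> h; rewrite -[RHS]h; apply: eq_bigr => j _; rewrite coef_map.
Qed.

Lemma monic_root (p : {poly R}) q : p \is monic -> root (map_poly i p) q ->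
  q ^+ (size p).-1 = - \sum_(j < (size p).-1) i p`_j * q ^+ j.
Proof.
move=> mp /root_sum; rewrite (polySpred (monic_neq0 mp)) big_ord_recr /= -lead_coefE.
by rewrite (monicP mp) rmorph1 mul1r => /eqP; rewrite addrC addr_eq0 => /eqP.
Qed.

(** If m^n0 clears q and d is the degree of a monic relation, m^(n0 d) clears q^k for k < d, and the
    relation reduces higher powers to these without a new denominator. *)
Lemma integral_almost q : Rbar i q -> almost_integral q.
Proof.
move=> [p [mp /(monic_root mp)]]; set d := (size p).-1 => e.
have [n0 [a0 e0]] := mpow_den q; exists (n0 * d)%N => n.
have [n_lt|] := ltnP n d.
  exists (m ^+ (n0 * (d - n)) * a0 ^+ n).
  have -> : (n0 * d = n0 * (d - n) + n0 * n)%N by rewrite -mulnDr subnK // ltnW.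
  by rewrite rmorphM [i (a0 ^+ n)]rmorphXn -e0 exprMn -rmorphXn -exprM mulrA -rmorphM -exprD.
elim/ltn_ind: n => n IH dn.
have -> : q ^+ n = q ^+ (n - d) * q ^+ d by rewrite -exprD subnK.
rewrite e mulrN mulrN mulr_sumr mulr_sumr; apply: (subringN imgR_subring).
apply: (subring_sum imgR_subring) => j _.
have -> : i (m ^+ (n0 * d)) * (q ^+ (n - d) * (i p`_j * q ^+ j)) =
  i p`_j * (i (m ^+ (n0 * d)) * q ^+ (n - d + j)) by rewrite exprD; ring.
apply: (subringM imgR_subring); first exact: imgR_i.
have lt : (n - d + j < n)%N by rewrite -{2}(subnK dn) ltn_add2l.
have [h|h] := ltnP (n - d + j) d; last exact: IH.
move: (n - d + j)%N h => k kd.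
exists (m ^+ (n0 * (d - k)) * a0 ^+ k).
have -> : (n0 * d = n0 * (d - k) + n0 * k)%N by rewrite -mulnDr subnK // ltnW.
by rewrite rmorphM [i (a0 ^+ k)]rmorphXn -e0 exprMn -rmorphXn -exprM mulrA -rmorphM -exprD.
Qed.

Section IntRing.
Variable A : Q -> Prop.
Hypothesis iA : int_ring A.
Let hA : subring A. Proof. by case: iA. Qed.

Lemma int_ring_i r : A (i r). Proof. by case: iA => _ h _; apply: h; exists r. Qed.
Let Ai := int_ring_i.

(** The element y = xa satisfies a monic relation whose lower coefficients lie in M. Read modulo 1 -
    y, it shows that 1 - y divides 1 + t with t in M, a unit of R. *)
Lemma M_jac_unit x a : M x -> A a -> is_unit_in A (1 - i x * a).
Proof.
move=> Mx Aa; have [p [mp]] : Rbar i a by case: iA => _ _; apply.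
move=> /(monic_root mp); set d := (size p).-1 => e.
pose y := i x * a.
have ey : y ^+ d = - \sum_(j < d) i (p`_j * x ^+ (d - j)) * y ^+ j.
  rewrite exprMn e mulrN mulr_sumr; congr (- _); apply: eq_bigr => j _.
  have -> : i x ^+ d = i x ^+ (d - j) * i x ^+ j by rewrite -exprD subnK // ltnW.
  by rewrite /y exprMn rmorphM rmorphXn; ring.
pose t := \sum_(j < d) p`_j * x ^+ (d - j).
have Mt : M t.
  apply: (idl_sum kM) => j _; apply: (idlMl kM) => //.
  by rewrite -(subnSK (ltn_ord j)) exprSr; apply: (idlMl kM).
have [u eu] := unit1D hloc hM Mt.
pose h n := \sum_(k < n) y ^+ k.
have eh n : 1 - y ^+ n = (1 - y) * h n.
  by rewrite -[1 - _]opprB subrX1 -mulNr opprB.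
have Ah n : A (h n).
  by apply: (subring_sum hA) => k _; apply: (subringX hA); apply: (subringM hA).
exists ((h d + \sum_(j < d) i (p`_j * x ^+ (d - j)) * h j) * i u); split.
  apply: (subringM hA) => //; apply: (subringD hA) => //.
  by apply: (subring_sum hA) => j _; apply: (subringM hA).
rewrite mulrA mulrDr -eh mulr_sumr.
have -> : \sum_(j < d) (1 - i x * a) * (i (p`_j * x ^+ (d - j)) * h j) =
    i t + y ^+ d.
  rewrite ey -sumrN rmorph_sum -big_split /=; apply: eq_bigr => j _.
  have -> : (1 - i x * a) * (i (p`_j * x ^+ (d - j)) * h j) =
    i (p`_j * x ^+ (d - j)) * ((1 - y) * h j) by rewrite /y; ring.
  by rewrite -eh; ring.
have -> : 1 - y ^+ d + (i t + y ^+ d) = i (1 + t) by rewrite rmorphD rmorph1; ring.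
by rewrite -rmorphM eu rmorph1.
Qed.

Lemma maximal_M N r : maximal_in A N -> N (i r) <-> M r.
Proof.
move=> mN; have [hN [N1 _]] := mN; split=> [Nr|Mr].
  apply: contrapT => /(local_unit hloc hM) [y e]; apply: N1.
  by rewrite -(rmorph1 i) -e rmorphM; apply: (idlMr hN).
apply: contrapT => Nr.
have [a [n [Aa Nn e]]] := maximal_comax hA mN (Ai r) Nr.
apply: (unit_not_max mN (M_jac_unit Mr Aa)).
by rewrite -e addrAC subrr add0r.
Qed.

(* A/cA is zero-dimensional, hence strongly pi-regular. *)
Lemma pi_regular b c : A b -> nzd c ->
  exists n e e', [/\ A e, A e' & b ^+ n = b ^+ n.+1 * e + i c * e'].
Proof.
move=> Ab hc; have [p [mp /root_sum e]] : Rbar i b by case: iA => _ _; apply.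
(* Cut the integral equation of b at its lowest coefficient outside M: that coefficient is a unit,
   and the part [nu] below it is nilpotent modulo c. *)
have ex : exists n, `[< ~ M p`_n >].
  exists (size p).-1; apply/asboolP; rewrite -lead_coefE (monicP mp); exact: M1.
have [n /asboolP Mn nmin] := ex_minnP ex.
have nlt : (n < size p)%N.
  by rewrite ltnNge; apply/negP => h; apply: Mn; rewrite nth_default //; apply: (idl0 kM).
have [v ev] := local_unit hloc hM Mn.
pose nu := \sum_(j < n) i p`_j * b ^+ j.
pose tail := \sum_(j < size p - n.+1) i p`_(j + n.+1) * b ^+ j.
have Atail : A tail.
  by apply: (subring_sum hA) => j _; apply: (subringM hA) => //; apply: (subringX hA).
have dec : nu + i p`_n * b ^+ n + b ^+ n.+1 * tail = 0.
  rewrite -e -(big_mkord xpredT (fun j => i p`_j * b ^+ j)) (@big_cat_nat _ _ _ n.+1) //=.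
  rewrite big_nat_recr //= big_mkord; congr (_ + _).
  rewrite -[X in \sum_(X <= _ < _) _](add0n n.+1) big_addn big_mkord mulr_sumr.
  by apply: eq_bigr => j _; rewrite exprD; ring.
have nilnu : nilmod A (i c) nu.
  rewrite /nu; elim/big_ind: _ => [||j _].
  - by split; [apply: subring0|exists 1, 0; rewrite mulr0 expr1; split=> //; apply: subring0].
  - by move=> ? ?; apply: nilmodD.
  rewrite mulrC; apply: nilmodM => //; first exact: subringX.
  split=> //; have Mj : M p`_j.
    by apply: contrapT => Mj; have := nmin j; rewrite leqNgt ltn_ord => /(_ (asboolT Mj)).
  have [k [r er]] := nzd_dvd_pow hloc hdim hM hc Mj.
  by exists k, (i r); split=> //; rewrite -rmorphXn er rmorphM.
have [_ [L [a [Aa ea]]]] : nilmod A (i c) (- i v * nu).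
  by apply: nilmodM => //; apply: subringN.
(* Raised to the power L, the left side becomes b^(nL) (1 - bf) and the right side falls into cA. *)
have ebn : b ^+ n * (1 + b * (i v * tail)) = - i v * nu.
  have -> : - i v * nu = - i v * (nu + i p`_n * b ^+ n + b ^+ n.+1 * tail)
     + (i p`_n * i v) * b ^+ n + i v * b ^+ n.+1 * tail by ring.
  by rewrite dec -rmorphM ev rmorph1 exprS; ring.
have Aw : A (b * (i v * tail)) by do ![apply: (subringM hA)].
have [f [Af ef]] : exists f, A f /\ (1 + b * (i v * tail)) ^+ L = 1 - b * f.
  elim: L {ea} => [|L [f [Af IH]]].
    by exists 0; split; [apply: subring0|rewrite expr0 mulr0 subr0].
  exists (f - (i v * tail) * (1 - b * f)); split; last by rewrite exprS IH; ring.
  apply: (subringB hA) => //; do !apply: (subringM hA) => //.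
  by apply: (subringB hA); [apply: subring1|apply: subringM].
exists (n * L)%N, f, a; split=> //.
move: ea; rewrite -ebn exprMn -exprM ef => <-; rewrite exprS; ring.
Qed.

(** For y in the radical, pi-regularity gives y^n (1 - ey) in mA with 1 - ey a unit. This
    elementwise description allows the radicals of different overrings to be compared. *)
Lemma jac_nilmod y : jac_in A y <-> nilmod A (i m) y.
Proof.
split=> [jy|[Ay [n [a [Aa e]]]]].
  have [Ay hy] := jy; split=> //.
  have [n [e [e' [Ae Ae' eq]]]] := pi_regular Ay hm.
  have [u [Au eu]] : is_unit_in A (1 - e * y).
    by apply: (jac_unit hA); apply: (idlMl (jac_ideal hA)).
  exists n, (e' * u); split; first exact: subringM.
  have -> : i m * (e' * u) = (i m * e') * u by ring.
  have -> : i m * e' = y ^+ n * (1 - e * y) by rewrite mulrBr mulr1 {1}eq exprS; ring.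
  by rewrite -mulrA eu mulr1.
split=> // N mN; have [hN _] := mN.
apply: (maximal_pow hA mN Ay (n := n)); rewrite e; apply: (idlMr hN) => //.
exact/(maximal_M _ mN).
Qed.

Lemma jac_M r : jac_in A (i r) <-> M r.
Proof.
split=> [[_ h]|Mr]; last by split=> // N mN; apply/(maximal_M _ mN).
have [||N [mN _]] := maximal_above (I0 := fun x => x = 0) (A := A).
- split; first by move=> x ->; apply: subring0.
  by split=> //; split=> [x y -> ->|a x _ ->]; rewrite ?addr0 ?mulr0.
- by move/eqP; rewrite oner_eq0.
by apply/(maximal_M _ mN); apply: h.
Qed.

End IntRing.
End Overrings.

(** * Finitely generated fractional ideals *)

Section Span.
Variables (R Q : comNzRingType) (i : {rmorphism R -> Q}).
Hypotheses (hQ : is_total_quotient i).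

Definition Rspan (g : seq Q) z := exists c : nat -> R, z = \sum_(j < size g) i (c j) * g`_j.

Lemma RspanD g x y : Rspan g x -> Rspan g y -> Rspan g (x + y).
Proof.
move=> [c ->] [d ->]; exists (fun j => c j + d j); rewrite -big_split /=.
by apply: eq_bigr => j _; rewrite rmorphD mulrDl.
Qed.

Lemma RspanM g r x : Rspan g x -> Rspan g (i r * x).
Proof.
move=> [c ->]; exists (fun j => r * c j); rewrite mulr_sumr.
by apply: eq_bigr => j _; rewrite rmorphM mulrA.
Qed.

Lemma Rspan_mem g j : (j < size g)%N -> Rspan g g`_j.
Proof.
move=> lt; exists (fun k => (k == j)%:R); rewrite (bigD1 (Ordinal lt)) //= eqxx rmorph1 mul1r.
rewrite big1 ?addr0 // => k /negPf nk; have -> : (k == j :> nat) = false by exact: nk.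
by rewrite rmorph0 mul0r.
Qed.

Lemma Rspan_sum g (K : eqType) (s : seq K) (F : K -> Q) :
  (forall k, k \in s -> Rspan g (F k)) -> Rspan g (\sum_(k <- s) F k).
Proof.
move=> h; rewrite big_seq; elim/big_ind: _ => //; last exact: RspanD.
by exists (fun=> 0); rewrite big1 // => j _; rewrite rmorph0 mul0r.
Qed.

(** The determinant trick: if C is a matrix of multiplication by e on the generators, det(e - C)
    kills the span, which contains a unit of Q. *)
Lemma Rspan_integral g e : (exists v w, Rspan g v /\ v * w = 1) ->
  (forall z, Rspan g z -> Rspan g (e * z)) -> Rbar i e.
Proof.
move=> [v [w [[d ev] vw]]] he.
have [|f hf] := @choice 'I_(size g) (nat -> R)
  (fun j c => e * g`_j = \sum_(k < size g) i (c k) * g`_k).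
  by move=> j; apply: he; apply: Rspan_mem.
pose C := \matrix_(j < size g, k < size g) f j k.
pose G := \col_(j < size g) g`_j.
pose B := e%:M - map_mx i C.
have BG : B *m G = 0.
  apply/eqP; rewrite mulmxBl mul_scalar_mx subr_eq0; apply/eqP/colP => j.
  by rewrite !mxE hf; apply: eq_bigr => k _; rewrite !mxE.
have dG : \det B *: G = 0.
  by rewrite -mul_scalar_mx -mul_adj_mx -mulmxA BG mulmx0.
have d0 : \det B = 0.
  rewrite -[LHS]mulr1 -vw ev mulrA mulr_sumr big1 ?mul0r // => j _.
  by have := congr1 (fun X : 'cV_(size g) => X j 0) dG; rewrite !mxE => h; rewrite mulrCA h mulr0.
exists (char_poly C); split; first exact: char_poly_monic.
rewrite rootE -horner_evalE -2!det_map_mx -[X in _ == X]d0; apply/eqP; congr (\det _).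
rewrite raddfB/= map_scalar_mx; apply/matrixP => j k.
by rewrite !mxE raddfB raddfMn/= map_polyX map_polyC /horner_eval !hornerE.
Qed.

(** A common denominator b turns the span into a finitely generated regular ideal; its inverse is
    regrouped into one coefficient [a j] per generator. *)
Lemma fin_stable_Rspan g : fin_stable_ring i -> (exists v w, Rspan g v /\ v * w = 1) ->
  exists a : nat -> Q, \sum_(j < size g) g`_j * a j = 1 /\
    forall j z w, Rspan g z -> Rspan g w -> Rspan g (a j * z * w).
Proof.
move=> hfs [v [w [sv vw]]].
have [b [hb den]] := common_denom hQ g.
have [f hf] := seq_choice 0 den.
have [b' eb'] := nzd_unit hQ hb.
pose s := map f g.
have es j : (j < size g)%N -> i s`_j = i b * g`_j.
  by move=> lt; rewrite (nth_map 0) // -hf ?mem_nth // mulrC.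
pose I x := exists c : seq R, size c = size s /\ x = \sum_(j < size s) c`_j * s`_j.
have sz : size s = size g by rewrite size_map.
have img z : img_ideal i I (i b * z) <-> Rspan g z.
  split=> [[x [[c [sc ex]] e]]|[c ->]].
    exists (fun j => c`_j); rewrite -[LHS]mul1r -eb' mulrAC e ex sz rmorph_sum mulr_suml.
    by apply: eq_bigr => j _; rewrite rmorphM es // mulrA mulrAC; rewrite -[RHS]mulr1 -eb'; ring.
  exists (\sum_(j < size s) c j * s`_j); split.
    exists (mkseq c (size s)); rewrite size_mkseq; split=> //.
    by apply: eq_bigr => j _; rewrite nth_mkseq.
  rewrite sz rmorph_sum mulr_sumr; apply: eq_bigr => j _.
  by rewrite rmorphM es // mulrCA.
have iI x : I x <-> Rspan g (i x * b').
  rewrite -img; have -> : i b * (i x * b') = i x by rewrite mulrCA eb' mulr1.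
  by split=> [Ix|[y [Iy /(i_inj hQ) ->]]] //; exists x.
have I_id : is_ideal I.
  split; first by apply/iI; rewrite rmorph0 mul0r; apply/img; exists 0; rewrite mulr0 rmorph0;
    split=> //; exists (nseq (size s) 0); rewrite size_nseq; split=> //;
    rewrite big1 // => j _; rewrite nth_nseq if_same mul0r.
  split=> [x y /iI hx /iI hy|r x /iI hx]; apply/iI.
    by rewrite rmorphD mulrDl; apply: RspanD.
  by rewrite rmorphM -mulrA; apply: RspanM.
have I_reg : regular_ideal I.
  have [x [Ix ex]] := proj2 (img v) sv; exists x; split=> //.
  apply: (@nzd_of_unit _ _ i hQ _ (b' * w)); rewrite -ex.
  by rewrite mulrACA eb' vw mulr1.
have I_fg : fin_gen_ideal I by exists s => x.
have /(stable_fracP hQ I_id I_reg)[t [ht t1]] := hfs I I_id I_fg I_reg.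
have [|c hc] := @seq_choice (Q * Q)%type (nat -> R)
   (fun p c => p.1 = i b * \sum_(j < size g) i (c j) * g`_j) t (fun=> 0).
  move=> p /ht [[x [Ix ex]] _]; have /iI [d ed] := Ix.
  by exists d; rewrite -ed ex mulrCA eb' mulr1.
exists (fun j => \sum_(p <- t) i (c p j) * i b * p.2); split.
  rewrite -t1; under eq_bigr do rewrite mulr_sumr.
  rewrite exchange_big; apply: eq_big_seq => p pt /=.
  by rewrite [in RHS](hc p pt) mulr_sumr mulr_suml; apply: eq_bigr => j _; ring.
move=> j z u /img Iz /img Iu; rewrite -img !mulr_suml mulr_sumr.
rewrite (_ : \sum_(k <- t) _ = \sum_(p <- t) i (c p j) * (p.2 * (i b * z) * (i b * u))); last first.
  by apply: eq_bigr => p _; ring.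
have iI' y : img_ideal i I y <-> Rspan g (b' * y).
  by rewrite -img mulrA eb' mul1r.
apply/iI'; rewrite mulr_sumr; apply: Rspan_sum => p pt.
rewrite mulrCA; apply: RspanM; apply/iI'; have [_] := ht _ pt; exact.
Qed.

Lemma Rspan2P u v t : Rspan [:: u; v] t <-> exists a b, t = i a * u + i b * v.
Proof.
split=> [[c ->]|[a [b ->]]].
  by exists (c 0), (c 1); rewrite /= !big_ord_recl big_ord0 /= addr0.
by exists (fun j => [:: a; b]`_j); rewrite /= !big_ord_recl big_ord0 /= addr0.
Qed.

Lemma Rspan3P u v w t : Rspan [:: u; v; w] t <-> exists a b c, t = i a * u + i b * v + i c * w.
Proof.
split=> [[c ->]|[a [b [c ->]]]].
  by exists (c 0), (c 1), (c 2); rewrite /= !big_ord_recl big_ord0 /= addr0 addrA.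
by exists (fun j => [:: a; b; c]`_j); rewrite /= !big_ord_recl big_ord0 /= addr0 addrA.
Qed.
End Span.

(** * Finitely stable rings *)

Section FinStable.
Variables (R Q : comNzRingType) (i : {rmorphism R -> Q}) (M : R -> Prop) (m : R).
Hypotheses (hQ : is_total_quotient i).
Hypotheses (hloc : local_ring R) (hdim : krull_dim_one R) (hM : maximal_ideal M).
Hypotheses (hmM : M m) (hm : nzd m).

Lemma Rseq_subring n : subring (Rseq i n) /\ psub (imgR i) (Rseq i n).
Proof.
elim: n => [|n [IH1 IH2]]; first by split=> //; apply: imgR_subring.
have hJ := jac_ideal IH1; split.
  split=> [x|x y hx hy z hz|x y hx hy z hz]; first by rewrite mul1r.
    by rewrite mulrBl; apply: (idlB IH1 hJ); [apply: hx|apply: hy].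
  by rewrite -mulrA; apply: hx; apply: hy.
by move=> x Rx y; apply: (idlMl hJ); apply: IH2.
Qed.

Lemma Rseq_sub n k : (n <= k)%N -> psub (Rseq i n) (Rseq i k).
Proof.
move=> /subnK <-; elim: (k - n)%N => [//|d IH] x /IH Rx y.
exact: (idlMl (jac_ideal (proj1 (Rseq_subring _)))).
Qed.

Lemma Rinf_Rseq n : psub (Rseq i n) (Rinf i).
Proof. by move=> x hx; exists n; apply: (Rseq_sub (leqnSn n)). Qed.

Hypothesis hfs : fin_stable_ring i.

(* Writing 1 = a0 + x a1 with a0, a1 in the inverse of I = R + xR over E(I), pi-regularity of
   a1 modulo m^(2s) puts (x a1)^n x in E(I), and (1 - x a1) x = a0 x is in E(I) as well. *)
Lemma almost_integral_quadratic x : almost_integral i m x ->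
  exists a b, x * x = i a * x + i b.
Proof.
move=> [s hs].
pose I := Rspan i [:: 1; x].
have I1 : I 1 by apply/Rspan2P; exists 1, 0; rewrite rmorph1 rmorph0; ring.
have Ix : I x by apply/Rspan2P; exists 0, 1; rewrite rmorph1 rmorph0; ring.
have [|a [ea ha]] := fin_stable_Rspan hQ (g := [:: 1; x]) hfs.
  by exists 1, 1; rewrite mulr1; split.
rewrite /= !big_ord_recl big_ord0 /= in ea.
have e1 : a 0 = 1 - x * a 1 by rewrite -ea /bump /=; ring.
(* This is E(I), tested on the generators 1 and x only. *)
pose E e := I e /\ I (e * x).
have IE e : E e -> forall z, I z -> I (e * z).
  move=> [Ie Iex] z /Rspan2P [c [d ->]].
  have -> : e * (i c * 1 + i d * x) = i c * e + i d * (e * x) by ring.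
  by apply: RspanD; apply: RspanM.
have hE : int_ring i E.
  split.
  - split; first by split; rewrite ?mul1r.
      move=> y z [Iy Iyx] [Iz Izx]; split; rewrite ?mulrBl -[X in _ - X]mul1r -(rmorph1 i) -mulNr -rmorphN;
        by apply: RspanD => //; apply: RspanM.
    by move=> y z Ey [Iz Izx]; split; rewrite -?mulrA; apply: IE.
  - move=> _ [r ->]; split; last exact: RspanM.
    by rewrite -[i r]mulr1; apply: RspanM.
  move=> e Ee; apply: (@Rspan_integral _ _ _ [:: 1; x]); last exact: IE.
  by exists 1, 1; rewrite mulr1; split.
have Ea j : E (a j).
  split; first by have := ha j 1 1 I1 I1; rewrite !mulr1.
  by have := ha j 1 x I1 Ix; rewrite mulr1.
have Eax j : E (a j * x).
  split; first by have := ha j 1 x I1 Ix; rewrite mulr1.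
  exact: ha.
have hER : subring E by case: hE.
have [n [e [e' [Ee Ee' eq]]]] :=
  pi_regular hloc hdim hM hE (Ea 1) (nzdX (n := s + s) hm).
set g := a 1 * x in Eax.
have Eg : E g by apply: Eax.
have E1g : E ((1 - g) * x) by have := Eax 0; rewrite e1 /g [x * _]mulrC.
have Egn : E (g ^+ n * x).
  have -> : g ^+ n * x = g ^+ n.+1 * e + i (m ^+ s) * (i (m ^+ s) * x ^+ n.+1) * e'.
    have -> : g ^+ n * x = a 1 ^+ n * x ^+ n.+1 by rewrite /g exprMn exprSr mulrA.
    by rewrite eq exprD rmorphM /g !exprMn; ring.
  apply: (subringD hER); first by apply: (subringM hER) => //; apply: subringX.
  apply: (subringM hER) => //; apply: (subringM hER); case: hE => _ h _; apply: h.
    exact: imgR_i.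
  exact: hs.
have Ex : E x.
  have -> : x = g ^+ n * x + (\sum_(k < n) g ^+ k) * ((1 - g) * x).
    have -> : (\sum_(k < n) g ^+ k) * ((1 - g) * x) = (1 - g ^+ n) * x.
      by rewrite -[1 - g ^+ n]opprB subrX1; ring.
    by ring.
  apply: (subringD hER) => //; apply: (subringM hER) => //.
  by apply: (subring_sum hER) => k _; apply: subringX.
by have [_ /Rspan2P [c [d ->]]] := Ex; exists d, c; ring.
Qed.

Lemma quadratic_integral a b x : x * x = i a * x + i b -> Rbar i x.
Proof.
move=> e; apply: (@Rspan_integral _ _ i [:: 1; x]).
  by exists 1, 1; rewrite mulr1; split=> //; apply/Rspan2P; exists 1, 0; rewrite rmorph1 rmorph0; ring.
move=> z /Rspan2P [c [d ->]]; apply/Rspan2P; exists (d * b), (c + d * a).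
rewrite rmorphD !rmorphM.
have -> : x * (i c * 1 + i d * x) = i c * x + i d * (x * x) by ring.
by rewrite e; ring.
Qed.

(** For I = R + xR + yR, the module T = R + xR + yR + xyR is closed under multiplication by x and y
    and is spanned by products of two elements of I. So two inverse factors [a j * a k] carry T into
    I. *)
Lemma Rbar_quadratic : quadratic_ext (imgR i) (Rbar i).
Proof.
split; first by move=> _ [r ->]; apply: Rbar_i.
move=> x y Rx Ry.
have aint z : Rbar i z -> exists a b, z * z = i a * z + i b.
  by move/(integral_almost hQ hloc hdim hM hmM)/almost_integral_quadratic.
have [p [q ex]] := aint x Rx; have [r [t ey]] := aint y Ry.
pose I := Rspan i [:: 1; x; y].
have I1 : I 1 by apply/Rspan3P; exists 1, 0, 0; rewrite rmorph1 rmorph0; ring.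
have Ix : I x by apply/Rspan3P; exists 0, 1, 0; rewrite rmorph1 rmorph0; ring.
have Iy : I y by apply/Rspan3P; exists 0, 0, 1; rewrite rmorph1 rmorph0; ring.
have [|a [ea ha]] := fin_stable_Rspan hQ (g := [:: 1; x; y]) hfs.
  by exists 1, 1; rewrite mulr1; split.
pose T u := exists c0 c1 c2 c3, u = i c0 + i c1 * x + i c2 * y + i c3 * (x * y).
have Txy : T (x * y) by exists 0, 0, 0, 1; rewrite rmorph1 rmorph0; ring.
have Tx u : T u -> T (u * x).
  move=> [c0 [c1 [c2 [c3 ->]]]]; exists (c1 * q), (c0 + c1 * p), (c3 * q), (c2 + c3 * p).
  rewrite !rmorphD !rmorphM.
  have -> : (i c0 + i c1 * x + i c2 * y + i c3 * (x * y)) * x =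
    i c0 * x + i c1 * (x * x) + i c2 * (x * y) + i c3 * (x * x) * y by ring.
  by rewrite ex; ring.
have Ty u : T u -> T (u * y).
  move=> [c0 [c1 [c2 [c3 ->]]]]; exists (c2 * t), (c3 * t), (c0 + c2 * r), (c1 + c3 * r).
  rewrite !rmorphD !rmorphM.
  have -> : (i c0 + i c1 * x + i c2 * y + i c3 * (x * y)) * y =
    i c0 * y + i c1 * (x * y) + i c2 * (y * y) + i c3 * (y * y) * x by ring.
  by rewrite ey; ring.
have Tg u (j : 'I_3) : T u -> T (u * [:: 1; x; y]`_j).
  by case: j => [[|[|[|]]]] //= _; rewrite ?mulr1 //; [apply: Tx|apply: Ty].
have aaT j k u : T u -> I (a j * a k * u).
  have h v w : I v -> I w -> I (a j * a k * (v * w)).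
    move=> Iv Iw; have -> : a j * a k * (v * w) = a j * v * (a k * 1 * w) by ring.
    by apply: (ha) => //; apply: ha.
  move=> [c0 [c1 [c2 [c3 ->]]]].
  have -> : a j * a k * (i c0 + i c1 * x + i c2 * y + i c3 * (x * y)) =
    i c0 * (a j * a k * (1 * 1)) + i c1 * (a j * a k * (1 * x)) +
    i c2 * (a j * a k * (1 * y)) + i c3 * (a j * a k * (x * y)) by ring.
  by do ![apply: RspanD]; apply: RspanM; apply: h.
have : I (x * y).
  (* Multiply xy by the square of the relation [ea]. *)
  have -> : x * y = \sum_(j < 3) \sum_(k < 3)
      a j * a k * (x * y * [:: 1; x; y]`_j * [:: 1; x; y]`_k).
    pose g := [:: 1; x; y].
    transitivity ((\sum_(j < 3) g`_j * a j) * (\sum_(k < 3) g`_k * a k) * (x * y)).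
      by rewrite [\sum_(j < 3) _]ea !mul1r.
    rewrite !mulr_suml; apply: eq_bigr => j _; rewrite mulr_sumr mulr_suml.
    by apply: eq_bigr => k _; rewrite /g; ring.
  by do 2!(apply: Rspan_sum => ? _); apply: aaT; do 2!apply: (Tg).
move=> /Rspan3P [c0 [c1 [c2 ->]]]; exists (i c1), (i c2), (i c0).
by do !split; try exact: imgR_i; ring.
Qed.

(** Since m lies in Jac R_n, m^(n+1) clears all of R_(n+1), in particular all powers of one element,
    which is then quadratic over R. *)
Lemma Rseq_Rbar n : psub (Rseq i n) (Rbar i) /\
  forall q, Rseq i n q -> imgR i (i (m ^+ n) * q).
Proof.
elim: n => [|n [IH1 IH2]].
  split; first by move=> _ [r ->]; apply: Rbar_i.
  by move=> q hq; rewrite rmorph1 mul1r.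
have [Rn Rin] := Rseq_subring n.
have iA : int_ring i (Rseq i n) by split.
have den q : Rseq i n.+1 q -> imgR i (i (m ^+ n.+1) * q).
  move=> hq; rewrite exprSr rmorphM -mulrA; apply: IH2.
  rewrite mulrC; by have [] := hq (i m) (proj2 (jac_M hloc hM iA m) hmM).
split=> // q hq; have [|a [b e]] := @almost_integral_quadratic q; last exact: quadratic_integral e.
by exists n.+1 => k; apply: (den); apply: (subringX (proj1 (Rseq_subring n.+1))).
Qed.

Lemma Rinf_quadratic : quadratic_ext (imgR i) (Rinf i).
Proof.
split; first by move=> x hx; exists 0; apply: (proj2 (Rseq_subring 1)).
move=> x y [n hx] [k hy]; have [_ h] := Rbar_quadratic; apply: h.
  exact: (proj1 (Rseq_Rbar n.+1)).
exact: (proj1 (Rseq_Rbar k.+1)).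
Qed.

End FinStable.

(** * At most two maximal ideals in the integral closure *)

Section Comax.
Variables (Q : comNzRingType) (A : Q -> Prop).
Hypothesis hA : subring A.

Lemma maximal_eq N N' : maximal_in A N -> maximal_in A N' -> psub N N' -> N = N'.
Proof.
move=> [_ [_ maxN]] [hN' [N'1 _]] NN'; apply: peqE => x; split; first exact: NN'.
exact: maxN.
Qed.

Lemma distinct_comax N N' : maximal_in A N -> maximal_in A N' -> N <> N' ->
  exists a b, [/\ N a, N' b & a + b = 1].
Proof.
move=> mN mN' neq; have [hN _] := mN.
have [x [Nx N'x]] : exists x, N x /\ ~ N' x.
  apply: contrapT => h; apply: neq; apply: maximal_eq => // x Nx.
  by apply: contrapT => N'x; apply: h; exists x.
have [a [b [Aa Nb e]]] := maximal_comax hA mN' (idlS hN Nx) N'x.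
by exists (x * a), b; split=> //; apply: (idlMr hN).
Qed.

End Comax.

Section FinStable.
Variables (R Q : comNzRingType) (i : {rmorphism R -> Q}) (M : R -> Prop) (m : R).
Hypotheses (hQ : is_total_quotient i).
Hypotheses (hloc : local_ring R) (hdim : krull_dim_one R) (hM : maximal_ideal M).
Hypotheses (hmM : M m) (hm : nzd m).
Hypothesis hfs : fin_stable_ring i.

(* With x = (1,0,1) and y = (0,1,1) modulo the three ideals, every element of E(I) for
   I = (x, y, m) has scalar residues, so the inverse of I sends I into the three ideals. *)
Lemma no_three_maximal N1 N2 N3 : maximal_in (Rbar i) N1 -> maximal_in (Rbar i) N2 ->
  maximal_in (Rbar i) N3 -> N1 <> N2 -> N1 <> N3 -> N2 <> N3 -> False.
Proof.
move=> m1 m2 m3 n12 n13 n23.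
have hA := Rbar_subring i; have iA := Rbar_int_ring i.
have [h1 _] := m1; have [h2 _] := m2; have [h3 [N31 _]] := m3.
have maxM N r (mN : maximal_in (Rbar i) N) := maximal_M hloc hM iA r mN.
have Ai r : Rbar i (i r) by exact: Rbar_i.
have Nm N : maximal_in (Rbar i) N -> N (i m) by move=> mN; apply/(maxM _ _ mN).
have exy Na Nb : maximal_in (Rbar i) Na -> maximal_in (Rbar i) Nb -> Na <> Nb ->
    N3 <> Na -> Nb <> N3 -> exists x, [/\ Rbar i x, Na x, Nb (1 - x) & N3 (1 - x)].
  move=> ma mb nab n3a nb3; have [ha _] := ma; have [hb _] := mb.
  have nba : Nb <> Na by move=> e; apply: nab.
  have [a [b [Ba Ab e]]] := distinct_comax hA mb ma nba.
  have [a' [b' [Ba' Ab' e']]] := distinct_comax hA m3 ma n3a.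
  have Ra := idlS hb Ba; have Ra' := idlS h3 Ba'.
  (* Both a and a' are 1 modulo Na, while a vanishes at Nb and a' at N3. *)
  exists (1 - a * a'); split.
  - by apply: (subringB hA); [apply: subring1|apply: subringM].
  - have -> : 1 - a * a' = b + a * b' + (1 - (a + b)) + a * (1 - (a' + b')) by ring.
    by rewrite e e' !subrr mulr0 !addr0; apply: (idlD ha) => //; apply: (idlMl ha).
  - by rewrite subKr; apply: (idlMr hb).
  - by rewrite subKr; apply: (idlMl h3).
have [x [Rx x2 x1 x3]] : exists x, [/\ Rbar i x, N2 x, N1 (1 - x) & N3 (1 - x)].
  by apply: exy => //; [move=> e; apply: n12|move=> e; apply: n23].
have [y [Ry y1 y2 y3]] : exists y, [/\ Rbar i y, N1 y, N2 (1 - y) & N3 (1 - y)].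
  by apply: exy => //; move=> e; apply: n13.
pose I := Rspan i [:: x; y; i m].
have Ix : I x by apply/Rspan3P; exists 1, 0, 0; rewrite rmorph1 rmorph0; ring.
have Iy : I y by apply/Rspan3P; exists 0, 1, 0; rewrite rmorph1 rmorph0; ring.
have Im : I (i m) by apply/Rspan3P; exists 0, 0, 1; rewrite rmorph1 rmorph0; ring.
have Iu : exists v w, I v /\ v * w = 1.
  by have [c ec] := nzd_unit hQ hm; exists (i m), c.
have [a [ea ha]] := fin_stable_Rspan hQ hfs Iu.
rewrite /= !big_ord_recl big_ord0 /= addr0 /bump /= in ea.
pose E e := forall z, I z -> I (e * z).
have ER e : E e -> Rbar i e by apply: Rspan_integral.

(* Write ex = rx + by + cm. At N2, where x is 0 and y is 1, this puts b in M; at N1 and N3, where x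
   is 1, it then gives e = r. *)
have sc1 e : E e -> exists r, N1 (e - i r) /\ N3 (e - i r).
  move=> Ee; have Re := ER _ Ee; have /Rspan3P [r [b [c ex]]] := Ee _ Ix.
  have Mb : M b.
    apply/(maxM _ _ m2).
    have -> : i b = e * x - i r * x - i c * i m + i b * (1 - y) by rewrite ex; ring.
    apply: (idlD h2); last exact: (idlMl h2).
    apply: (idlB hA h2); last by apply: (idlMl h2) => //; apply: Nm.
    by apply: (idlB hA h2); apply: (idlMl h2).
  have key N : maximal_in (Rbar i) N -> N (1 - x) -> N (e - i r).
    move=> mN Nx; have [hN _] := mN.
    have -> : e - i r = (e - i r) * (1 - x) + (i b * y + i c * i m).
      have -> : i b * y + i c * i m = e * x - i r * x by rewrite ex; ring.
      by ring.
    apply: (idlD hN); first by apply: (idlMl hN) => //; apply: (subringB hA).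
    apply: (idlD hN); last by apply: (idlMl hN) => //; apply: Nm.
    by apply: (idlMr hN) => //; apply/(maxM _ _ mN).
  by exists r; split; apply: key.
have sc2 e : E e -> exists r, N2 (e - i r) /\ N3 (e - i r).
  move=> Ee; have Re := ER _ Ee; have /Rspan3P [b [r [c ex]]] := Ee _ Iy.
  have Mb : M b.
    apply/(maxM _ _ m1).
    have -> : i b = e * y - i r * y - i c * i m + i b * (1 - x) by rewrite ex; ring.
    apply: (idlD h1); last exact: (idlMl h1).
    apply: (idlB hA h1); last by apply: (idlMl h1) => //; apply: Nm.
    by apply: (idlB hA h1); apply: (idlMl h1).
  have key N : maximal_in (Rbar i) N -> N (1 - y) -> N (e - i r).
    move=> mN Nx; have [hN _] := mN.
    have -> : e - i r = (e - i r) * (1 - y) + (i b * x + i c * i m).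
      have -> : i b * x + i c * i m = e * y - i r * y by rewrite ex; ring.
      by ring.
    apply: (idlD hN); first by apply: (idlMl hN) => //; apply: (subringB hA).
    apply: (idlD hN); last by apply: (idlMl hN) => //; apply: Nm.
    by apply: (idlMr hN) => //; apply/(maxM _ _ mN).
  by exists r; split; apply: key.
have to3 N e : maximal_in (Rbar i) N -> (exists r, N (e - i r) /\ N3 (e - i r)) -> N e -> N3 e.
  move=> mN [r [Nr N3r]] Ne; have [hN _] := mN.
  have Mr : M r.
    apply/(maxM _ _ mN); have -> : i r = e - (e - i r) by ring.
    exact: (idlB hA hN).
  by rewrite -(subrK (i r) e); apply: (idlD h3) => //; apply/(maxM _ _ m3).
have Ea j z : I z -> E (a j * z) by move=> Iz w Iw; apply: ha.
(* At N1, where x is 1 and y is 0, [a j * y] agrees with [a j * x * y] and so vanishes; its residue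
   at N3 is the same scalar. *)
have ayx j : N3 (a j * y).
  apply: (to3 N1) => //; first exact/sc1/Ea.
  have -> : a j * y = a j * y * (1 - x) + a j * x * y by ring.
  by apply: (idlD h1); apply: (idlMl h1) => //; apply/ER/Ea.
have axy j : N3 (a j * x).
  apply: (to3 N2) => //; first exact/sc2/Ea.
  have -> : a j * x = a j * x * (1 - y) + a j * y * x by ring.
  by apply: (idlD h2); apply: (idlMl h2) => //; apply/ER/Ea.
apply: N31; rewrite -ea.
apply: (idlD h3); first by rewrite mulrC.
apply: (idlD h3); first by rewrite mulrC.
have -> : i m * a 2 = a 2 * i m * (1 - x) + a 2 * x * i m by ring.
by apply: (idlD h3); apply: (idlMl h3) => //; [apply/ER/Ea|apply/ER/Ea|apply: Nm].
Qed.

Lemma Rbar_two_maximal : at_most_two_max (Rbar i).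
Proof.
move=> N1 N2 N3 m1 m2 m3.
have [->|n12] := pselect (N1 = N2); first by left.
have [->|n13] := pselect (N1 = N3); first by right; left.
have [->|n23] := pselect (N2 = N3); first by right; right.
by case: (no_three_maximal m1 m2 m3).
Qed.

End FinStable.

(** * Overrings with invertible Jacobson radical *)

(** Invertibility with second factors taken from the full quotient (A : I). *)
Definition inv_ideal {Q : comNzRingType} (A I : Q -> Prop) := exists t : seq (Q * Q),
  (forall p, p \in t -> I p.1 /\ forall z, I z -> A (p.2 * z)) /\
  \sum_(p <- t) p.1 * p.2 = 1.

Section Closed.
Variables (R Q : comNzRingType) (i : {rmorphism R -> Q}) (M : R -> Prop) (m : R).
Hypotheses (hQ : is_total_quotient i).
Hypotheses (hloc : local_ring R) (hdim : krull_dim_one R) (hM : maximal_ideal M).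
Hypotheses (hmM : M m) (hm : nzd m).
Variable A : Q -> Prop.
Hypotheses (iA : int_ring i A) (invJ : inv_ideal A (jac_in A)).
Let hA : subring A. Proof. by case: iA. Qed.
Let Ai r : A (i r). Proof. exact: int_ring_i iA r. Qed.
Let jacP y := jac_nilmod hloc hdim hM hmM hm iA y.

Definition almost_in (q : Q) := exists s, forall n, A (i (m ^+ s) * q ^+ n).

Lemma integral_almost_in q : Rbar i q -> almost_in q.
Proof.
move=> /(integral_almost hQ hloc hdim hM hmM) [s hs]; exists s => n.
by case: iA => _ h _; apply: h.
Qed.

Lemma almost_inM g h : almost_in g -> almost_in h ->
  almost_in (g * h).
Proof.
move=> [s hs] [k hk]; exists (s + k)%N => n.
have -> : i (m ^+ (s + k)) * (g * h) ^+ n = (i (m ^+ s) * g ^+ n) * (i (m ^+ k) * h ^+ n).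
  by rewrite exprD rmorphM exprMn; ring.
exact: (subringM hA).
Qed.

(** With j^n in mA, the power j^(n(s+1)) supplies m^(s+1): m^s clears the power of g and one factor
    m remains. *)
Lemma jac_almost_in g j : almost_in g -> jac_in A j -> A (j * g) -> jac_in A (j * g).
Proof.
move=> [s hs] /jacP [_ [n [a [Aa e]]]] Ajg; apply/jacP; split=> //.
exists (n * s.+1)%N, (i (m ^+ s) * g ^+ (n * s.+1) * a ^+ s.+1); split.
  by apply: (subringM hA) => //; apply: subringX.
by rewrite exprMn [j ^+ _]exprM e exprMn rmorphXn exprS; ring.
Qed.

(* Induction on the total exponent, with J = Jac A: if J g lies in A, then it lies in J,
   because a power of j in J kills the denominator of the powers of g; hence g lies in J^-1 J = A. *)
Lemma completely_closed g : almost_in g -> A g.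
Proof.
have [t [ht t1]] := invJ.
have step h : almost_in h -> (forall p, p \in t -> A (p.1 * h)) -> A h.
  move=> aih hp; have -> : h = \sum_(p <- t) p.2 * (p.1 * h).
    by rewrite -[LHS]mul1r -t1 mulr_suml; apply: eq_bigr => p _; ring.
  apply: (subring_sum hA) => p pt; have [Jp] := ht _ pt; apply.
  by apply: jac_almost_in => //; apply: hp.
(* The exponents are attached to the values [p.1], so that repeated generators share one; each
   application of [step] lowers a positive exponent. *)
have main N : forall (h : Q) (e : Q -> nat), almost_in h ->
    (forall p, p \in t -> A (p.1 ^+ e p.1 * h)) -> (\sum_(p <- t) e p.1 <= N)%N -> A h.
  elim: N => [|N IH] h e aih he hN; have [[p [pt ep]]|npos] := pselect (exists p, p \in t /\ e p.1 = 0).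
  - by have := he _ pt; rewrite ep mul1r.
  - apply: (step) => // p pt; case: npos; exists p; split=> //.
    move: hN; rewrite (big_rem _ pt) /= leqn0 addn_eq0 => /andP[/eqP h0 _].
    by rewrite h0.
  - by have := he _ pt; rewrite ep mul1r.
  apply: (step) => // p pt; have [Jp _] := ht _ pt; have [Ap _] := Jp.
  have ep : (0 < e p.1)%N by rewrite lt0n; apply/eqP => e0; apply: npos; exists p.
  apply: (IH _ (fun z => if z == p.1 then (e z).-1 else e z)).
  - apply: almost_inM => //; apply: integral_almost_in.
    by case: iA => _ _; apply.
  - move=> q qt; have Aq := he _ qt; case: eqP => [eq|_].
      by rewrite eq in Aq *; rewrite mulrA -exprSr prednK.
    by rewrite mulrCA; apply: (subringM hA).
  rewrite -ltnS; apply: leq_trans hN; rewrite (big_rem _ pt) [X in (_ < X)%N](big_rem _ pt) /= eqxx.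
  rewrite -addSn prednK // leq_add2l; apply: leq_sum => q _.
  by case: eqP => // _; apply: leq_pred.
move=> aig; have [s hs] := aig.
have [|e he] := @choice Q nat (fun z n => jac_in A z -> A (z ^+ n * g)).
  move=> z; have [/jacP [_ [n [a [Aa e]]]]|nz] := pselect (jac_in A z); last by exists 0.
  exists (n * s)%N => _; rewrite exprM e exprMn -rmorphXn mulrAC.
  apply: (subringM hA); last exact: subringX.
  by have := hs 1; rewrite expr1.
by apply: (main _ g e aig _ (leqnn _)) => p pt; apply: he; case: (ht _ pt).
Qed.

Lemma Rbar_sub : psub (Rbar i) A.
Proof. by move=> q /integral_almost_in; apply: completely_closed. Qed.

Hypothesis two : at_most_two_max A.

(** If N is the only maximal ideal, N = J. Otherwise take n1 + n2 = 1 with n1 in N and n2 in N2: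
    then n2 N lies in J, so n2 J^-1 lies in N^-1. *)
Lemma maximal_invertible N : maximal_in A N -> inv_ideal A N.
Proof.
move=> mN; have [hN _] := mN; have [t [ht t1]] := invJ.
have [[N2 [mN2 neq]]|only] := pselect (exists N2, maximal_in A N2 /\ N <> N2); last first.
  exists t; split=> // p /ht [[_ Jp] h]; split; first exact: Jp.
  move=> z Nz; apply: h; split; first exact: (idlS hN).
  move=> N' mN'; have [<-//|neq] := pselect (N = N').
  by case: only; exists N'.
have [hN2 _] := mN2.
have capJ z : N z -> N2 z -> jac_in A z.
  move=> Nz N2z; split; first exact: (idlS hN).
  move=> N' mN'; case: (two mN mN2 mN') => [/peqE//|[]/peqE <-//].
have [n1 [n2 [Nn1 Nn2 e]]] := distinct_comax hA mN mN2 neq.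
exists ((n1, 1) :: [seq (p.1, n2 * p.2) | p <- t]); split; last first.
  rewrite big_cons big_map /= mulr1 -[RHS]e; congr (_ + _).
  by rewrite -[RHS]mulr1 -t1 mulr_sumr; apply: eq_bigr => p _; ring.
move=> p; rewrite inE => /predU1P[->|/mapP[q qt ->]] /=.
  by split=> // z Nz; rewrite mul1r; apply: (idlS hN).
have [[_ Jq] hq] := ht _ qt; split; first exact: Jq.
move=> z Nz; have -> : n2 * q.2 * z = q.2 * (n2 * z) by ring.
apply: hq; apply: capJ; first by apply: (idlMl hN) => //; apply: (idlS hN2).
by apply: (idlMr hN2) => //; apply: (idlS hN).
Qed.

(* If I I^-1 were contained in a maximal ideal N, then N^-1 would stabilize I^-1 and so, by
   complete integral closedness, be contained in A. *)
Lemma dedekind_of_jac : dedekind_in A.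
Proof.
move=> I hI [y [Iy hy]].
pose L q := forall x, I x -> A (x * q).
have LA a : A a -> L a by move=> Aa x Ix; apply: (subringM hA) => //; apply: (idlS hI).
exists L; split.
  split; first by apply: LA; apply: subring0.
  split=> [u v Lu Lv x Ix|a u Aa Lu x Ix].
    by rewrite mulrDr; apply: (subringD hA); [apply: Lu|apply: Lv].
  by rewrite mulrCA; apply: (subringM hA) => //; apply: Lu.
split; first by move=> x q Ix; apply.
pose H z := exists s : seq (Q * Q), (forall p, p \in s -> I p.1 /\ L p.2) /\
  \sum_(p <- s) p.1 * p.2 = z.
suff [s [hs s1]] : H 1 by exists s.
apply: contrapT => nH1.
have hH : ideal_in A H.
  split.
    move=> _ [s [hs <-]]; apply: (subring_sum hA) => p /hs [Ip]; exact.
  split; first by exists [::]; rewrite big_nil.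
  split=> [_ _ [s [hs <-]] [s' [hs' <-]]|a _ Aa [s [hs <-]]].
    exists (s ++ s'); rewrite big_cat; split=> // p; rewrite mem_cat => /orP[]; [exact: hs|exact: hs'].
  exists [seq (a * p.1, p.2) | p <- s]; split.
    by move=> _ /mapP[p /hs [Ip Lp] ->]; split=> //; apply: (idlMl hI).
  by rewrite big_map mulr_sumr; apply: eq_bigr => p _; rewrite mulrA.
have IL_H x l : I x -> L l -> H (x * l).
  by move=> Ix Ll; exists [:: (x, l)]; rewrite big_seq1; split=> // p; rewrite inE => /eqP->.
have [N [mN HN]] := maximal_above hH nH1.
have [hN [N1 _]] := mN.
have [t [ht t1]] := maximal_invertible mN.
(* Regularity in A passes to Q because a power of m carries any element of Q into R. *)
have [y' yy'] : exists y', y * y' = 1.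
  apply: (nzdQ_unit hQ) => z yz.
  have [n [r er]] := mpow_den hQ hloc hdim hM hmM z.
  have [c ec] := nzd_unit hQ (nzdX (n := n) hm).
  have : i (m ^+ n) * z = 0.
    by rewrite er; apply: hy; rewrite ?Ai // -er mulrCA yz mulr0.
  by move=> e; rewrite -[z]mul1r -ec mulrAC e mul0r.
have tA p : p \in t -> A p.2.
  move=> pt; have [_ hp] := ht _ pt; apply: completely_closed.
  have Lp l : L l -> L (p.2 * l).
    by move=> Ll x Ix; rewrite mulrCA; apply: hp; apply: HN; apply: IL_H.
  have Lpn n : L (p.2 ^+ n).
    elim: n => [|n IH]; first by apply: LA; apply: subring1.
    by rewrite exprS; apply: Lp.
  have [n0 [r er]] := mpow_den hQ hloc hdim hM hmM y'.
  exists n0 => n; have -> : i (m ^+ n0) * p.2 ^+ n = i r * (y * p.2 ^+ n).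
    by rewrite -er -[LHS]mul1r -yy'; ring.
  by apply: (subringM hA) => //; apply: Lpn.
apply: N1; rewrite -t1; apply: (idl_sum hN) => p pt; have [Np _] := ht _ pt.
by apply: (idlMr hN) => //; apply: tA.
Qed.

End Closed.

(** * Quadratic rings *)

Section QuadraticRing.
Variables (R Q : comNzRingType) (i : {rmorphism R -> Q}) (M : R -> Prop) (m : R).
Hypotheses (hQ : is_total_quotient i).
Hypotheses (hloc : local_ring R) (hdim : krull_dim_one R) (hM : maximal_ideal M).
Hypotheses (hmM : M m) (hm : nzd m).
Variable s : seq (Q * Q).
Hypothesis hs : forall p, p \in s -> img_ideal i M p.1 /\
  forall z w, img_ideal i M z -> img_ideal i M w -> img_ideal i M (p.2 * z * w).
Hypothesis s1 : \sum_(p <- s) p.1 * p.2 = 1.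

Let kM := proj1 (is_ideal_in M) (M_ideal hM).

Lemma jac_img z : jac_in (imgR i) z <-> img_ideal i M z.
Proof.
have iR : int_ring i (imgR i).
  by split=> //; [apply: imgR_subring|move=> _ [r ->]; apply: Rbar_i].
split=> [jz|[r [Mr ->]]]; last exact/(jac_M hloc hM iR).
have [[r er] _] := jz; exists r; split=> //; move: jz.
by rewrite er => /(jac_M hloc hM iR).
Qed.

(** * Overrings of R_1 that are quadratic over R: the radical modulo MB *)

Section Over.
Variable B : Q -> Prop.
Hypotheses (iB : int_ring i B) (R1B : psub (Rseq i 1) B).
Hypothesis qB : forall x y, B x -> B y -> exists a b c, x * y = i a * x + i b * y + i c.

Let hB : subring B. Proof. by case: iB. Qed.
Let Bi r : B (i r). Proof. exact: int_ring_i iB r. Qed.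
Let hJ := jac_ideal hB.

(* The extension of M to B: the pairs in s give an inverse of M, so z lies in M B exactly when
   every p.2 * z lies in B. *)
Definition extM z := forall p, p \in s -> B (p.2 * z).

Lemma extMD x y : extM x -> extM y -> extM (x + y).
Proof. by move=> hx hy p ps; rewrite mulrDr; apply: (subringD hB); [apply: hx|apply: hy]. Qed.

Lemma extMM a x : B a -> extM x -> extM (a * x).
Proof. by move=> Ba hx p ps; rewrite mulrCA; apply: (subringM hB) => //; apply: hx. Qed.

Lemma extMB x y : extM x -> extM y -> extM (x - y).
Proof.
move=> hx hy; rewrite -[y]mul1r -mulNr; apply: extMD => //; apply: extMM => //.
by apply: (subringN hB); apply: subring1.
Qed.

(** The products [p.2 * i r] lie in E(M) = R_1, which B contains. *)
Lemma extM_M r : M r -> extM (i r).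
Proof.
move=> Mr p ps; apply: R1B => z /jac_img Mz; apply/jac_img.
by have [_] := hs ps; apply=> //; exists r.
Qed.

Lemma extM_jac z : extM z -> jac_in B z.
Proof.
move=> hz; have -> : z = \sum_(p <- s) p.2 * z * p.1.
  by rewrite -[LHS]mul1r -s1 mulr_suml; apply: eq_bigr => p _; ring.
apply: (idl_sum hJ) => p ps; apply: (idlMl hJ); first exact: hz.
by have [[r [Mr ->]] _] := hs ps; apply/(jac_M hloc hM iB).
Qed.

Lemma jac_shift x r : jac_in B x -> ~ M r -> is_unit_in B (x - i r).
Proof.
move=> jx /(local_unit hloc hM) [v ev].
have [|u [Bu eu]] := jac_unit hB (x := i v * x); first exact: (idlMl hJ).
exists (- i v * u); split; first by apply: (subringM hB) => //; apply: (subringN hB).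
by rewrite -[RHS]eu -(rmorph1 i) -ev rmorphM; ring.
Qed.

Lemma sq1 x : B x -> exists a b, x * x = i a * x + i b.
Proof.
by move=> Bx; have [a [b [c ->]]] := qB Bx Bx; exists (a + b), c; rewrite rmorphD; ring.
Qed.

(** In x^2 = ax + b the term b lies in M. If a is in M, the right side is in MB; otherwise x - a is
    a unit, and x (x - a) = b puts x itself in MB. *)
Lemma jac_sq1 x : jac_in B x -> extM (x * x).
Proof.
move=> jx; have [Bx _] := jx; have [a [b e]] := sq1 Bx.
have Mb : M b.
  apply/(jac_M hloc hM iB); have -> : i b = x * x - i a * x by rewrite e; ring.
  by apply: (idlB hB hJ); apply: (idlMl hJ).
have [Ma|Ma] := pselect (M a).
  rewrite e mulrC; apply: extMD; last exact: extM_M.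
  by apply: extMM => //; apply: extM_M.
have [u [Bu eu]] := jac_shift jx Ma.
have ex : x = u * i b.
  have -> : i b = x * (x - i a) by rewrite mulrBr e; ring.
  by rewrite mulrCA [u * _]mulrC eu mulr1.
by apply: extMM => //; rewrite ex; apply: extMM => //; apply: extM_M.
Qed.

(* In B / M B, squares of nilpotents vanish, hence so do their products. *)
Lemma jac_sq x z : jac_in B x -> jac_in B z -> extM (x * z).
Proof.
move=> jx jz; have [Bx _] := jx; have [Bz _] := jz.
have [a [b [c e]]] := qB Bx Bz.
have Mc : M c.
  apply/(jac_M hloc hM iB); have -> : i c = x * z - i a * x - i b * z by rewrite e; ring.
  by do 2?apply: (idlB hB hJ); apply: (idlMl hJ).
have unit_case (r : R) w : ~ M r -> extM (i r * w) -> extM w.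
  move=> /(local_unit hloc hM) [v ev] h.
  have -> : w = i v * (i r * w) by rewrite mulrA -rmorphM [v * r]mulrC ev rmorph1 mul1r.
  exact: extMM.
have [Mb|Mb] := pselect (M b); last first.
  apply: (unit_case b) => //.
  have -> : i b * (x * z) = z * (x * x) - i a * (x * x) - x * i c.
    have -> : z * (x * x) = x * (x * z) by ring.
    by rewrite {2}e; ring.
  apply: extMB; last by apply: extMM => //; apply: extM_M.
  by apply: extMB; apply: extMM => //; apply: jac_sq1.
have [Ma|Ma] := pselect (M a); last first.
  apply: (unit_case a) => //.
  have -> : i a * (x * z) = x * (z * z) - i b * (z * z) - z * i c.
    have -> : x * (z * z) = z * (x * z) by ring.
    by rewrite {2}e; ring.
  apply: extMB; last by apply: extMM => //; apply: extM_M.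
  by apply: extMB; apply: extMM => //; apply: jac_sq1.
rewrite e [i a * x]mulrC [i b * z]mulrC.
by do 2?apply: extMD; do ?[apply: extMM => //]; apply: extM_M.
Qed.

(* If B is not local, e is idempotent modulo M B and neither component of B / M B has nilpotents:
   squaring x1 + (1 - e) with x1 = e x nilpotent would otherwise violate quadraticity. *)
Lemma nonlocal_half e x : B e -> ~ is_unit_in B e -> ~ is_unit_in B (1 - e) ->
  jac_in B x -> extM (e * x).
Proof.
move=> Be ne n1e jx; have [Bx _] := jx.
have B1 := subring1 hB; have B1e : B (1 - e) by apply: subringB.
have [N1 [mN1 N1e]] := nonunit_maximal hB Be ne.
have [N2 [mN2 N2e]] := nonunit_maximal hB B1e n1e.
have [h1 _] := mN1; have [h2 _] := mN2.
have maxM N r (mN : maximal_in B N) := maximal_M hloc hM iB r mN.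
have jN N z : maximal_in B N -> jac_in B z -> N z by move=> mN [_]; apply.
(* The residues of e are 0 at N1 and 1 at N2, which forces b in M and a in 1 + M. *)
have idem : extM (e * (1 - e)).
  have [a [b ee]] := sq1 Be.
  have Mb : M b.
    apply/(maxM _ _ mN1); have -> : i b = e * e - i a * e by rewrite ee; ring.
    by apply: (idlB hB h1); apply: (idlMl h1).
  have Ma : M (1 - a).
    apply/(maxM _ _ mN2).
    have -> : i (1 - a) = (1 - e) * (1 + e - i a) + i b.
      have -> : i b = e * e - i a * e by rewrite ee; ring.
      by rewrite rmorphB rmorph1; ring.
    apply: (idlD h2); last exact/(maxM _ _ mN2).
    by apply: (idlMr h2) => //; apply: (subringB hB) => //; apply: (subringD hB).
  have -> : e * (1 - e) = e * i (1 - a) - i b by rewrite mulrBr mulr1 ee rmorphB rmorph1; ring.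
  by apply: extMB; [apply: extMM => //|]; apply: extM_M.
pose y := e * x + (1 - e).
have By : B y by apply: (subringD hB) => //; apply: (subringM hB).
have [a [b ey]] := sq1 By.
have jex : jac_in B (e * x) by apply: (idlMl hJ).
have rest : extM ((1 - e) - i a * (e * x) - i a * (1 - e) - i b).
  have -> : (1 - e) - i a * (e * x) - i a * (1 - e) - i b =
     (1 - e) - y * y.
    by rewrite ey /y; ring.
  have -> : (1 - e) - y * y = e * (1 - e) - (e * x) * (e * x) - (x + x) * (e * (1 - e)).
    by rewrite /y; ring.
  apply: extMB; last by apply: extMM => //; apply: (subringD hB).
  by apply: extMB => //; apply: jac_sq1.
have Mb : M b.
  apply/(maxM _ _ mN2).
  have -> : i b = (1 - e) * (1 - i a) - i a * (e * x) -
     ((1 - e) - i a * (e * x) - i a * (1 - e) - i b) by ring.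
  apply: (idlB hB h2); last by apply: jN => //; apply: extM_jac.
  apply: (idlB hB h2); last by apply: (idlMl h2) => //; apply: jN.
  by apply: (idlMr h2) => //; apply: (subringB hB).
have Ma : M (1 - a).
  apply/(maxM _ _ mN1).
  have -> : i (1 - a) = e * (1 - i a) + i a * (e * x) + i b +
     ((1 - e) - i a * (e * x) - i a * (1 - e) - i b) by rewrite rmorphB rmorph1; ring.
  apply: (idlD h1); last by apply: jN => //; apply: extM_jac.
  apply: (idlD h1); last exact/(maxM _ _ mN1).
  apply: (idlD h1); last by apply: (idlMl h1) => //; apply: jN.
  by apply: (idlMr h1) => //; apply: (subringB hB).
(* Modulo MB, y^2 is 1 - e, while a = 1 and b = 0; so y^2 = ay + b leaves ex = 0. *)
have -> : e * x = (1 - e) * i (1 - a) + e * x * i (1 - a) - i b -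
  ((1 - e) - i a * (e * x) - i a * (1 - e) - i b) by rewrite rmorphB rmorph1; ring.
have Bex : B (e * x) by apply: subringM.
apply: extMB => //; apply: extMB; last exact: extM_M.
by apply: extMD; apply: extMM => //; apply: extM_M.
Qed.

Lemma nonlocal_jac e x : B e -> ~ is_unit_in B e -> ~ is_unit_in B (1 - e) ->
  jac_in B x -> extM x.
Proof.
move=> Be ne n1e jx; have -> : x = e * x + (1 - e) * x by ring.
apply: extMD; first exact: nonlocal_half.
apply: nonlocal_half => //; first by apply: (subringB hB) => //; apply: subring1.
by rewrite subKr.
Qed.

End Over.

Hypothesis hq : quadratic_ext (imgR i) (Rinf i).

Lemma Rinf_quad x y : Rinf i x -> Rinf i y -> exists a b c, x * y = i a * x + i b * y + i c.
Proof.
case: hq => _ h hx hy; have [_ [_ [_ [[a ->] [[b ->] [[c ->] ->]]]]]] := h _ _ hx hy.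
by exists a, b, c; ring.
Qed.

Lemma Rinf_int_ring : int_ring i (Rinf i).
Proof.
have up n k x y : Rseq i n x -> Rseq i k y -> Rseq i (maxn n k) x /\ Rseq i (maxn n k) y.
  by move=> hx hy; split; [apply: Rseq_sub hx; apply: leq_maxl|apply: Rseq_sub hy; apply: leq_maxr].
split.
- split; first by exists 0; apply: subring1; apply: (proj1 (Rseq_subring i 1)).
    move=> x y [n hx] [k hy]; have [h1 h2] := up _ _ _ _ hx hy.
    by apply: (@Rinf_Rseq _ _ _ (maxn n.+1 k.+1)); apply: (subringB (proj1 (Rseq_subring i _))).
  move=> x y [n hx] [k hy]; have [h1 h2] := up _ _ _ _ hx hy.
  by apply: (@Rinf_Rseq _ _ _ (maxn n.+1 k.+1)); apply: (subringM (proj1 (Rseq_subring i _))).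
- by case: hq.
move=> x hx; have [a [b [c e]]] := Rinf_quad hx hx.
by apply: (@quadratic_integral _ _ i (a + b) c); rewrite e rmorphD; ring.
Qed.

Lemma Rseq_int_ring n : int_ring i (Rseq i n).
Proof.
have [h1 h2] := Rseq_subring i n; split=> // x hx.
by have [_ _] := Rinf_int_ring; apply; apply: Rinf_Rseq hx.
Qed.

Let A := Rinf i.
Let iA := Rinf_int_ring.
Let hA : subring A. Proof. by case: iA. Qed.
Let Ai r : A (i r). Proof. exact: int_ring_i iA r. Qed.
Let R1A : psub (Rseq i 1) A. Proof. exact: Rinf_Rseq. Qed.
Let jacP B (iB : int_ring i B) y := jac_nilmod hloc hdim hM hmM hm iB y.

Lemma jac_Rseq_up n x : jac_in (Rseq i n) x -> jac_in A x.
Proof.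
move=> /(jacP (Rseq_int_ring n)) [Rx [k [a [Ra e]]]]; apply/(jacP iA).
by split; [apply: Rinf_Rseq Rx|exists k, a; split=> //; apply: Rinf_Rseq Ra].
Qed.

(** In x^k = ma the factor a need not lie in R_n, but it is quadratic over R: x^(2k) = m^2 a^2 = m
    ((b + c) x^k + md), with the cofactor of m in R_n. *)
Lemma jac_Rseq_down n x : Rseq i n x -> jac_in A x -> jac_in (Rseq i n) x.
Proof.
move=> Rx /(jacP iA) [_ [k [a [Aa e]]]]; apply/(jacP (Rseq_int_ring n)); split=> //.
have [b [c [d ea]]] := Rinf_quad Aa Aa.
have hR := proj1 (Rseq_subring i n).
have Ri r : Rseq i n (i r) by apply: (proj2 (Rseq_subring i n)); exists r.
exists (k + k)%N, (i (b + c) * x ^+ k + i m * i d); split.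
  apply: (subringD hR); apply: (subringM hR) => //; exact: subringX.
rewrite exprD e.
have -> : i m * a * (i m * a) = i m * i m * (a * a) by ring.
by rewrite ea rmorphD; ring.
Qed.

Lemma inv_of_extM : (forall x, jac_in A x -> extM A x) -> inv_ideal A (jac_in A).
Proof.
move=> h; exists s; split=> // p ps; split; last by move=> z /h; apply.
by have [[r [Mr ->]] _] := hs ps; apply/(jac_M hloc hM iA).
Qed.

Lemma jac_Rinf_inv : inv_ideal A (jac_in A).
Proof.
have sqA x z := @jac_sq A iA R1A Rinf_quad x z.
have [[e [Ae [ne n1e]]]|loc] := pselect (exists e, A e /\ ~ is_unit_in A e /\ ~ is_unit_in A (1 - e)).
  by apply: inv_of_extM => x; apply: (nonlocal_jac iA R1A Rinf_quad Ae ne n1e).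
have [[p [x [z [ps [jx [jz nj]]]]]]|hj] := pselect (exists p x z, p \in s /\
    jac_in A x /\ jac_in A z /\ ~ jac_in A (p.2 * (x * z))).
  (* No e has e and 1 - e both nonunits, so w = [p.2 * (x * z)] outside P is a unit of A. Then x is
     inverted by a multiple of [p.2 * z], which carries P into M^-1 P^2, hence into A. *)
  have Aw := sqA _ _ jx jz _ ps.
  have [N [mN Nw]] : exists N, maximal_in A N /\ ~ N (p.2 * (x * z)).
    apply: contrapT => h; apply: nj; split=> // N mN; apply: contrapT => Nw.
    by apply: h; exists N.
  have [a [n [Aa Nn e]]] := maximal_comax hA mN Aw Nw.
  have [hN _] := mN; have An := idlS hN Nn.
  have [u [Au eu]] : is_unit_in A (1 - n).
    apply: contrapT => h; apply: loc; exists n; split=> //; split=> // un.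
    exact: (unit_not_max mN un).
  have ew : p.2 * (x * z) * a = 1 - n by rewrite -e; ring.
  exists [:: (x, p.2 * z * a * u)]; split; last by rewrite big_seq1 /= -eu -ew; ring.
  move=> q; rewrite inE => /eqP -> /=; split=> // t jt.
  have -> : p.2 * z * a * u * t = p.2 * (z * t) * (a * u) by ring.
  by apply: (subringM hA); [apply: sqA|apply: subringM].
(* Now M^-1 P^2 lies in P. For x in Jac R_(n+1), [p.2 * x] maps Jac R_(n+1) into itself and so
   belongs to R_(n+2). *)
apply: inv_of_extM => x jx p ps.
have /(jacP iA) [[n Rx] _] := jx.
suff h z : jac_in (Rseq i n.+1) z -> jac_in (Rseq i n.+1) (p.2 * x * z) by exists n.+1.
move=> jz; have R1B : psub (Rseq i 1) (Rseq i n.+1) by apply: Rseq_sub.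
have qB y w : Rseq i n.+1 y -> Rseq i n.+1 w -> exists a b c, y * w = i a * y + i b * w + i c.
  by move=> hy hw; apply: Rinf_quad; exists n.
apply: (@jac_Rseq_down n.+1).
  by rewrite -mulrA; apply: (jac_sq (Rseq_int_ring n.+1) R1B qB) => //; apply: (@jac_Rseq_down n.+1).
apply: contrapT => nj; apply: hj; exists p, x, z.
by rewrite mulrA; split=> //; split=> //; split=> //; apply: jac_Rseq_up jz.
Qed.

Lemma Rbar_Rinf : Rbar i = Rinf i.
Proof.
apply: peqE => x; split; last by case: iA => _ _; apply.
exact: (Rbar_sub hQ hloc hdim hM hmM hm iA jac_Rinf_inv).
Qed.

End QuadraticRing.

(** * Quadratic extensions by a Dedekind ring *)

Section DedekindStable.
Variables (R Q : comNzRingType) (i : {rmorphism R -> Q}).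
Hypotheses (hQ : is_total_quotient i).
Variable A : Q -> Prop.
Hypotheses (hA : subring A) (hq : quadratic_ext (imgR i) A).
Hypotheses (dedA : dedekind_in A) (two : at_most_two_max A).
Variable I : R -> Prop.
Hypotheses (hI : is_ideal I) (rI : regular_ideal I).

Let kI := proj1 (is_ideal_in I) hI.
Let Ai r : A (i r). Proof. by case: hq => h _; apply: h; exists r. Qed.

Definition extend z := exists s : seq (R * Q), (forall p, p \in s -> I p.1 /\ A p.2) /\
  \sum_(p <- s) i p.1 * p.2 = z.

Lemma extend_ideal : ideal_in A extend.
Proof.
split.
  move=> _ [s [hs <-]]; apply: (subring_sum hA) => p /hs [_ Ap].
  exact: (subringM hA).
split; first by exists [::]; rewrite big_nil.
split=> [_ _ [s [hs <-]] [s' [hs' <-]]|a _ Aa [s [hs <-]]].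
  exists (s ++ s'); rewrite big_cat; split=> // p; rewrite mem_cat => /orP[]; [exact: hs|exact: hs'].
exists [seq (p.1, a * p.2) | p <- s]; split.
  by move=> _ /mapP[p /hs [Ip Ap] ->]; split=> //; apply: (subringM hA).
by rewrite big_map mulr_sumr; apply: eq_bigr => p _; rewrite mulrCA.
Qed.

Lemma extend_mem r : I r -> extend (i r).
Proof.
move=> Ir; exists [:: (r, 1)]; rewrite big_seq1 mulr1; split=> // p.
by rewrite inE => /eqP ->; split=> //; apply: subring1.
Qed.

(* An additive group is not the union of two proper subgroups, so some x in I generates I A
   at both maximal ideals. *)
Lemma extend_principal : exists x l, [/\ I x, i x * l = 1 & forall r, I r -> A (i r * l)].
Proof.
have [|L [[L0 [LD LM]] [hL [s [hs s1]]]]] := dedA extend_ideal.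
  have [y [Iy hy]] := rI; exists (i y); split; first exact: extend_mem.
  move=> z Az yz; have [c ec] := nzd_unit hQ hy.
  by rewrite -[z]mul1r -ec mulrAC yz mul0r.
have AIL r l : I r -> L l -> A (i r * l) by move=> Ir Ll; apply: hL => //; apply: extend_mem.
(* As L is an inverse of IA, this says that x generates IA locally at N. *)
pose good N x := exists l, L l /\ ~ N (i x * l).
have some_good N : maximal_in A N -> exists x, I x /\ good N x.
  move=> [hN [N1 _]]; apply: contrapT => h; apply: N1; rewrite -s1.
  apply: (idl_sum hN) => p /hs [[t [ht <-]] Lp]; rewrite mulr_suml.
  apply: (idl_sum hN) => q /ht [Iq Aq]; rewrite mulrAC mulrC; apply: (idlMl hN) => //.
  by apply: contrapT => nN; apply: h; exists q.1; split=> //; exists p.2.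
have [x [Ix gx]] : exists x, I x /\ forall N, maximal_in A N -> good N x.
  have [||N1 [mN1 _]] := maximal_above (I0 := fun x => x = 0) (A := A).
  - split; first by move=> x ->; apply: subring0.
    by split=> //; split=> [x y -> ->|a x _ ->]; rewrite ?addr0 ?mulr0.
  - by move/eqP; rewrite oner_eq0.
  have [x1 [Ix1 g1]] := some_good _ mN1.
  have [[N2 [mN2 neq]]|only] := pselect (exists N2, maximal_in A N2 /\ N1 <> N2); last first.
    exists x1; split=> // N mN; have [<-//|neq] := pselect (N1 = N).
    by case: only; exists N.
  have all2 N : maximal_in A N -> N = N1 \/ N = N2.
    by move=> mN; case: (two mN1 mN2 mN) => [/peqE//|[]/peqE ->]; [left|right].
  have [x2 [Ix2 g2]] := some_good _ mN2.
  have [g12|n12] := pselect (good N2 x1).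
    by exists x1; split=> // N /all2 [] ->.
  have [g21|n21] := pselect (good N1 x2).
    by exists x2; split=> // N /all2 [] ->.
  have sum_good N u v : maximal_in A N -> good N u -> ~ good N v -> good N (u + v).
    move=> [hN _] [l [Ll nu]] nv; exists l; split=> // Nuv; apply: nu.
    have Nv : N (i v * l) by apply: contrapT => h; apply: nv; exists l.
    have -> : i u * l = i (u + v) * l - i v * l by rewrite rmorphD; ring.
    exact: (idlB hA hN).
  exists (x1 + x2); split; first exact: (idlD kI).
  by move=> N /all2 [] ->; [|rewrite addrC]; apply: sum_good.
suff [l [Ll el]] : exists l, L l /\ i x * l = 1.
  by exists x, l; split=> // r Ir; apply: AIL.
apply: contrapT => h.
(* The ideal xL of A lies in no maximal ideal, so it contains 1. *)
have [|[l [Ll el]]|N [mN hN]] := @maximal_above _ A (fun z => exists l, L l /\ i x * l = z).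
- split; first by move=> _ [l [Ll <-]]; apply: AIL.
  split; first by exists 0; rewrite mulr0.
  split=> [_ _ [l [Ll <-]] [k [Lk <-]]|a _ Aa [l [Ll <-]]].
    by exists (l + k); rewrite mulrDr; split=> //; apply: LD.
  by exists (a * l); rewrite mulrCA; split=> //; apply: LM.
- by apply: h; exists l.
have [l [Ll]] := gx _ mN; apply; apply: hN; by exists l.
Qed.

(* l I contains 1, so it is a ring since R < A is quadratic: I = x (l I) is stable. *)
Lemma dedekind_stable : stable_frac (img_ideal i I).
Proof.
apply/(stable_fracP hQ hI rI).
have [x [l [Ix e hl]]] := extend_principal.
exists [:: (i x, l)]; rewrite big_seq1; split=> // p; rewrite inE => /eqP -> /=.
split; first by exists x.
move=> _ _ [a [Ia ->]] [b [Ib ->]].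
have [_ quad] := hq; have [_ [_ [_ [[c ->] [[d ->] [[f ->] eq]]]]]] := quad _ _ (hl _ Ia) (hl _ Ib).
exists (c * a + d * b + f * x); split.
  by do 2?apply: (idlD kI); apply: (idlMl kI).
have -> : l * i a * i b = (i x * l) * (l * i a * i b) by rewrite e mul1r.
have -> : i x * l * (l * i a * i b) = i x * (i a * l * (i b * l)) by ring.
have -> : i x * (i a * l * (i b * l)) = (i x * l) * (i a * i c + i b * i d) + i x * i f.
  by rewrite eq; ring.
by rewrite e !rmorphD !rmorphM; ring.
Qed.

End DedekindStable.

(** [quotient_stable] ranges over all realizations of R/J and of its total quotient ring, so the
    converse has to construct one of each. *)
Lemma stable_quotient (R Q : comNzRingType) (i : {rmorphism R -> Q}) (M : R -> Prop) (m : R) :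
  is_total_quotient i -> local_ring R -> krull_dim_one R -> maximal_ideal M -> M m -> nzd m ->
  stable_ring i <-> quotient_stable (Jm m).
Proof.
move=> hQ hloc hdim hM hmM hm; split=> [st S phi surj ker Q' j hj I' hI' rI'|qs I hI rI].
  apply/(stable_fracP hj hI' rI')/(stab_denP hj).
  apply: (stab_den_quotient hloc hdim hM hmM hm surj ker hI').
  have rI := regular_preimage hloc hdim hM hmM hm surj ker hI' rI'.
  have hI : is_ideal (fun r => I' (phi r)).
    have [I0 [ID IM]] := hI'; split; first by rewrite rmorph0.
    by split=> [x y hx hy|r x hx]; rewrite ?rmorphD ?rmorphM; [apply: ID|apply: IM].
  exact/(stab_denP hQ)/(stable_fracP hQ hI rI)/st.
have J1 : ~ Jm m 1.
  by move/(Jm_sub hM hmM); case: hM => _ [].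
have [S [phi [surj ker]]] := quotient_ring (Jm_ideal m) J1.
(* The image of J is already an ideal of Q, since Q = R[1/m] and J = m^n J; Q modulo it serves as
   total quotient ring of R/J. *)
pose JQ := img_ideal i (Jm m).
have kJ := proj1 (is_ideal_in _) (Jm_ideal m).
have hJQ : is_ideal JQ.
  split; first by exists 0; rewrite rmorph0; split=> //; apply: (idl0 kJ).
  split=> [_ _ [a [Ja ->]] [b [Jb ->]]|q _ [a [Ja ->]]].
    by exists (a + b); rewrite rmorphD; split=> //; apply: (idlD kJ).
  have [n [r er]] := mpow_den hQ hloc hdim hM hmM q.
  have [b [Jb ->]] := Jm_div hm n Ja.
  exists (r * b); rewrite !rmorphM -er rmorphXn; split; last by ring.
  exact: (idlMl kJ).
have JQ_i r : JQ (i r) <-> Jm m r.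
  by split=> [[a [Ja /(i_inj hQ) ->]]|Jr] //; exists r.
have [||Q' [psi [psurj pker]]] := @quotient_ring Q JQ.
- exact: hJQ.
- by rewrite -(rmorph1 i) JQ_i.
have [|j hj] := @induced_morphism R Q S Q' i phi psi surj.
  by move=> r /ker Jr; apply/pker/JQ_i.
have hQ' : is_total_quotient j.
  split.
    move=> x y; have [a <-] := surj x; have [b <-] := surj y; rewrite !hj => e.
    apply/(phi_eq ker)/JQ_i; rewrite rmorphB; apply/pker.
    by rewrite rmorphB e subrr.
  split=> [b'|q'].
    have [b <-] := surj b' => /(phi_nzd_dvd hloc hdim hM hmM ker) [n [r e]].
    have [c ec] := nzd_unit hQ (nzdX (n := n) hm).
    exists (psi (i r * c)); rewrite hj -rmorphM.
    have -> : i b * (i r * c) = i (b * r) * c by rewrite rmorphM; ring.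
    by rewrite rmorphM -hj -e hj -rmorphM ec rmorph1.
  have [q <-] := psurj q'; have [n [r er]] := mpow_den hQ hloc hdim hM hmM q.
  exists (phi r), (phi (m ^+ n)); split; first exact: (phi_nzd hloc hdim hM hmM hm surj ker (nzdX hm)).
  by rewrite !hj -rmorphM mulrC er.
have st := qs S phi surj ker Q' j hQ'.
apply/(stable_fracP hQ hI rI)/(stab_denP hQ).
apply: (stab_den_lift hloc hdim hM hmM hm surj ker hI rI).
pose I' s := exists r, I r /\ s = phi r.
have [I0 [ID IM]] := hI.
have hI' : is_ideal I'.
  split; first by exists 0; rewrite rmorph0.
  split=> [_ _ [a [Ia ->]] [b [Ib ->]]|s _ [a [Ia ->]]].
    by exists (a + b); rewrite rmorphD; split=> //; apply: ID.
  by have [r <-] := surj s; exists (r * a); rewrite rmorphM; split=> //; apply: IM.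
have rI' : regular_ideal I'.
  have [y [Iy hy]] := rI; exists (phi y); split; first by exists y.
  exact: (phi_nzd hloc hdim hM hmM hm surj ker).
exact/(stab_denP hQ')/(stable_fracP hQ' hI' rI')/st.
Qed.

Theorem theorem4p2 (R Q : comNzRingType) (i : {rmorphism R -> Q})
  (M : R -> Prop) (m : R)
  (hQ : is_total_quotient i) (hloc : local_ring R) (hdim : krull_dim_one R)
  (hM : maximal_ideal M) (hMreg : regular_ideal M)
  (hmM : M m) (hm : nzd m) :
  let J := fun r : R => forall k : nat, (0 < k)%N -> exists s : R, r = m ^+ k * s in
  [<-> stable_ring i;
       fin_stable_ring i /\ stable_frac (img_ideal i M);
       quadratic_ring i /\ at_most_two_max (Rbar i);
       quadratic_ext (imgR i) (Rbar i) /\ dedekind_in (Rbar i) /\ at_most_two_max (Rbar i);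
       quotient_stable J].
Proof.
move=> J; have qst : stable_ring i <-> quotient_stable J.
  exact: (stable_quotient hQ hloc hdim hM hmM hm).
tfae.
- move=> st; split; first by move=> I hI _; apply: st.
  by apply: st => //; apply: M_ideal.
- move=> [hfs hMs]; split; last exact: (Rbar_two_maximal hQ hloc hM hmM hm hfs).
  split=> //; split; last exact: (Rinf_quadratic hQ hloc hdim hM hmM hm hfs).
  by move=> N /(local_max hloc hM) ->.
- move=> [[_ [hMs hq]] two].
  have [_ /(stable_fracP hQ (M_ideal hM) hMreg) [s [hs s1]]] := hMs _ hM.
  have invJ := jac_Rinf_inv hloc hdim hM hmM hm hs s1 hq.
  have e := Rbar_Rinf hQ hloc hdim hM hmM hm hs s1 hq.
  rewrite e in two *; split=> //; split=> //.
  exact: (dedekind_of_jac hQ hloc hdim hM hmM hm (Rinf_int_ring hq) invJ two).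
(* Condition (4) gives stability of R itself; [qst] carries it to R/J and also closes the cycle. *)
- move=> [hq [ded two]]; apply/qst => I hI rI.
  exact: (dedekind_stable hQ (Rbar_subring i) hq ded two hI rI).
- by move/qst.
Qed.
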